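(* Let $\Gamma^*$ be the strongly regular graph with parameters $(120,56,28,24)$ defined in the context. Then $\Gamma^*$ cannot be constructed using the construction of Wallis or the construction of Goethals and Seidel (where, for the latter, the complement of the graph constructed by Goethals and Seidel is taken), nor does it arise as the non-collinearity graph of a partial geometry.
   Context: A strongly regular graph with parameters $(n,k,\lambda,\mu)$ is a $k$-regular graph on $n$ vertices in which two distinct vertices have $\lambda$ common neighbours if they are adjacent and $\mu$ if they are not. The constructions. The construction of Wallis is the one of W. D. Wallis, ''Construction of strongly regular graphs using affine designs'' (1971, Theorem 1, with its corrigendum). The construction of Goethals and Seidel is the one of J.-M. Goethals and J. J. Seidel, ''Strongly regular graphs derived from combinatorial designs'' (1970, Theorem 2.4). For the parameters considered here, both start from a $2$-$(15,3,1)$ design on a $15$-element set $A$, i.e. a set of $3$-subsets (blocks) of $A$ such that any two elements of $A$ lie in exactly one block; each element of $A$ is then in $7$ blocks. The vertex set is $A\times B$ with $|B|=8$. Wallis: for each $a\in A$ take an affine resolvable $2$-$(8,4,3)$ design on $\{a\}\times B$ (it has $7$ parallel classes, each consisting of two complementary $4$-sets), assign its parallel classes bijectively to the $7$ blocks through $a$, and label the two $4$-sets of each parallel class by $0$ and $1$. Vertices $(a,x)$ and $(b,y)$ are adjacent iff $a\neq b$ and, for the unique block containing $a$ and $b$, the $4$-sets containing $(a,x)$ and $(b,y)$ in the two assigned parallel classes have the same label. Goethals–Seidel: take the $15\times 35$ point-block incidence matrix of the design and a normalised Hadamard matrix of order $8$ (one column being all-one). In each row, replace the seven entries $1$ by the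 seven distinct other columns of the Hadamard matrix and each entry $0$ by a zero column of length $8$, giving a $120\times 35$ matrix $N$. Two distinct vertices (rows of $N$) are adjacent iff the corresponding entry of $NN^\top$ is $-1$. The complement of this graph is strongly regular with parameters $(120,56,28,24)$. A partial geometry with parameters $(s,t,\alpha)$ is a point-line geometry in which two distinct points are on at most one common line, every line has $s+1$ points, every point is on $t+1$ lines, and for each point $P$ not on a line $\ell$ there are exactly $\alpha$ lines through $P$ meeting $\ell$. Its collinearity graph has the points as vertices, distinct points being adjacent iff they are on a common line; the non-collinearity graph is the complement. The case relevant here is $(s,t,\alpha)=(7,8,4)$, for which the non-collinearity graph is strongly regular with parameters $(120,56,28,24)$. Definition of $\Gamma^*$. Let $V=\{x\in\mathbb F_2^9:\sum_i x_i=0\}$ and $f(X)=\sum_{1\le i<j\le 9}X_iX_j$, defining the hyperbolic quadric $\mathcal Q^+(7,2)$ in $\mathrm{PG}(V)=\mathrm{PG}(7,2)$. Generators are the maximal totally isotropic subspaces (projective dimension $3$); they split into two systems, $\pi,\rho$ being in the same system iff $\dim(\pi\cap\rho)$ is odd (projective dimension, $\dim\varnothing=-1$). A spread is a set of generators partitioning the points of the quadric; it has $9$ elements, all in the same system. Let $Q_i$ be the point whose coordinate vector has a single $0$, in position $i$, and for a spread $\mathcal S$ let $\mathcal S_i$ be its element containing $Q_i$. Let $G^*$ be the setwise stabiliser of $\{1,2\}$ in $\mathrm{Alt}_9$, acting by coordinate permutation. For each of the two systems of generators, $G^*$ has two orbits, of sizes $120$ and $840$, on the spreads consisting of generators of that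 system; let $\mathcal X$ be such an orbit of size $120$. For $\mathcal S,\mathcal T\in\mathcal X$ put $\mathrm{Inv}_1(\mathcal S,\mathcal T)=\dim(\mathcal S_1\cap\mathcal T_2)+\dim(\mathcal S_2\cap\mathcal T_1)$ and let $\mathrm{Inv}_2(\mathcal S,\mathcal T)$ be the number of generators in $\{\mathcal T_3,\dots,\mathcal T_9\}$ that meet both $\mathcal S_1$ and $\mathcal S_2$ in a line. $\Gamma^*$ is the graph on $\mathcal X$ in which distinct $\mathcal S,\mathcal T$ are adjacent iff $(\mathrm{Inv}_1(\mathcal S,\mathcal T),\mathrm{Inv}_2(\mathcal S,\mathcal T))\in\{(-2,2),(2,2),(0,3)\}$. *)

(* Defs.v *)
From HB Require Import structures.
From mathcomp Require Import all_boot all_order all_algebra all_fingroup all_solvable.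

Set Implicit Arguments.
Unset Strict Implicit.
Unset Printing Implicit Defensive.

Import GRing.Theory Num.Theory.
Local Open Scope ring_scope.

Definition graph_iso (T U : finType) (e : rel T) (e' : rel U) : Prop :=
  exists2 f : T -> U, bijective f & forall x y, e' (f x) (f y) = e x y.

Definition graph_compl (T : finType) (e : rel T) : rel T :=
  fun x y => (x != y) && ~~ e x y.

(* Over F_2 every projective point has exactly one nonzero coordinate vector,
   so points are nonzero vectors and projective subspaces are the sets of
   nonzero vectors of linear subspaces.  The positions 1, ..., 9 of the
   coordinates are the ordinals 0, ..., 8. *)
Definition vec := 'rV['F_2]_9.

Definition in_V (x : vec) : bool := \sum_i x 0 i == 0.

Definition qform (x : vec) : 'F_2 :=
  \sum_(i < 9) \sum_(j < 9 | (i < j)%N) x 0 i * x 0 j.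

Definition quadric : {set vec} :=
  [set x | [&& x != 0, in_V x & qform x == 0]].

Definition pspan (P : {set vec}) : {vspace vec} := <<enum P>>%VS.

Definition proj_subspace (P : {set vec}) : bool :=
  P == [set x | (x \in pspan P) && (x != 0)].

Definition pdim (P : {set vec}) : int := (\dim (pspan P))%:Z - 1.

Definition totally_isotropic (P : {set vec}) : bool :=
  proj_subspace P && (P \subset quadric).

Definition generators : {set {set vec}} :=
  [set P : {set vec} | maxset totally_isotropic P].

Definition same_system (P R : {set vec}) : bool := odd `|pdim (P :&: R)|%N.

Definition systems : {set {set {set vec}}} :=
  [set [set R in generators | same_system P R] | P in generators].

Definition spread (S : {set {set vec}}) : bool :=
  (S \subset generators) && partition S quadric.

Definition spreads_in (sys : {set {set vec}}) : {set {set {set vec}}} :=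
  [set S : {set {set vec}} | spread S && (S \subset sys)].

(* The coordinate in position [i] is moved to position [g i]. *)
Definition move_coords (x : vec) (g : 'S_9) : vec := col_perm g^-1 x.

Lemma move_coords1 : move_coords^~ 1%g =1 id.
Proof. by move=> x; rewrite /move_coords invg1 col_perm1. Qed.

Lemma move_coordsM x : act_morph move_coords x.
Proof. by move=> g h; rewrite /move_coords invMg col_permM. Qed.

Definition coord_action : {action 'S_9 &-> vec} :=
  TotalAction move_coords1 move_coordsM.

Definition family_action : {action 'S_9 &-> {set {set vec}}} :=
  (coord_action^*^*)%act.

Definition pos1 : 'I_9 := inord 0.
Definition pos2 : 'I_9 := inord 1.

Definition Gstar : {set 'S_9} := 'N_('Alt_('I_9))([set pos1; pos2] | 'P)%g.

Definition Qpoint (i : 'I_9) : vec := \row_j (j != i)%:R.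

(* Usually written S_i: the element of the spread S containing Q_i. *)
Definition spread_at (S : {set {set vec}}) (i : 'I_9) : {set vec} :=
  pblock S (Qpoint i).

Definition Inv1 (S T : {set {set vec}}) : int :=
  pdim (spread_at S pos1 :&: spread_at T pos2)
  + pdim (spread_at S pos2 :&: spread_at T pos1).

Definition Inv2 (S T : {set {set vec}}) : nat :=
  #|[set P in [set spread_at T i | i : 'I_9 & (1 < i)%N] |
      (pdim (P :&: spread_at S pos1) == 1) &&
      (pdim (P :&: spread_at S pos2) == 1)]|.

Definition Gamma_star_adj (S T : {set {set vec}}) : bool :=
  (S != T) &&
  ((Inv1 S T, Inv2 S T) \in
     [:: (- 2%:Z, 2%N); (2%:Z, 2%N); (0%:Z, 3%N)]).

Definition Gamma_star (X : {set {set {set vec}}}) : rel {S | S \in X} :=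
  fun S T => Gamma_star_adj (val S) (val T).

Definition design2 (P : finType) (v k l : nat) (D : {set {set P}}) : Prop :=
  [/\ #|P| = v,
      forall b, b \in D -> #|b| = k
    & forall x y, x != y -> #|[set b in D | (x \in b) && (y \in b)]| = l].

Definition blocks_at (P : finType) (D : {set {set P}}) (x : P) :
  {set {set P}} := [set b in D | x \in b].

(* [R] is the set of parallel classes. *)
Definition affine_resolvable (P : finType) (D : {set {set P}})
    (R : {set {set {set P}}}) : Prop :=
  [/\ partition R D,
      forall C, C \in R -> partition C [set: P]
    & exists m, forall C C' b b', C \in R -> C' \in R -> C != C' ->
        b \in C -> b' \in C' -> #|b :&: b'| = m].

Section Wallis.
Variables A B : finType.

(* [cls a l] is the parallel class (of the affine design at [a]) assigned to
   the block [l] through [a], and [lab a l] labels the two members of it. *)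
Definition Wallis_data (L : {set {set A}}) (cls : A -> {set A} -> {set {set B}})
    (lab : A -> {set A} -> {set B} -> bool) : Prop :=
  design2 15 3 1 L /\
  forall a, exists D : {set {set B}}, exists R : {set {set {set B}}},
    [/\ design2 8 4 3 D, affine_resolvable D R,
        {in blocks_at L a &, injective (cls a)},
        cls a @: blocks_at L a = R
      & forall l, l \in blocks_at L a -> {in cls a l &, injective (lab a l)}].

Definition Wallis_adj (L : {set {set A}}) (cls : A -> {set A} -> {set {set B}})
    (lab : A -> {set A} -> {set B} -> bool) : rel (A * B) :=
  fun u v => (u.1 != v.1) &&
    [exists l in L, [&& u.1 \in l, v.1 \in l
      & lab u.1 l (pblock (cls u.1 l) u.2) == lab v.1 l (pblock (cls v.1 l) v.2)]].

End Wallis.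

Definition from_Wallis (T : finType) (e : rel T) : Prop :=
  exists A B : finType, exists (L : {set {set A}})
    (cls : A -> {set A} -> {set {set B}}) (lab : A -> {set A} -> {set B} -> bool),
    Wallis_data L cls lab /\ graph_iso e (Wallis_adj L cls lab).

Definition Hadamard (n : nat) (H : 'M[int]_n) : Prop :=
  (forall i j, H i j = 1 \/ H i j = -1) /\ H *m H^T = n%:R%:M.

Section GoethalsSeidel.
Variable A : finType.

(* [j0] is the all-one column, and [col a l] is the column of [H] replacing the
   entry 1 of the incidence matrix in row [a] and column [l]. *)
Definition GS_data (L : {set {set A}}) (H : 'M[int]_8) (j0 : 'I_8)
    (col : A -> {set A} -> 'I_8) : Prop :=
  [/\ design2 15 3 1 L, Hadamard H, forall i, H i j0 = 1,
      forall a, {in blocks_at L a &, injective (col a)}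
    & forall a l, l \in blocks_at L a -> col a l != j0].

(* The matrix N, its rows indexed by A x 'I_8 and its columns by the blocks. *)
Definition GS_matrix (H : 'M[int]_8) (col : A -> {set A} -> 'I_8)
    (u : A * 'I_8) (l : {set A}) : int :=
  if u.1 \in l then H u.2 (col u.1 l) else 0.

Definition GS_adj (L : {set {set A}}) (H : 'M[int]_8)
    (col : A -> {set A} -> 'I_8) : rel (A * 'I_8) :=
  fun u v => (u != v) &&
    (\sum_(l in L) GS_matrix H col u l * GS_matrix H col v l == -1).

End GoethalsSeidel.

Definition from_GS_compl (T : finType) (e : rel T) : Prop :=
  exists A : finType, exists (L : {set {set A}}) (H : 'M[int]_8) (j0 : 'I_8)
    (col : A -> {set A} -> 'I_8),
    GS_data L H j0 col /\ graph_iso e (graph_compl (GS_adj L H col)).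

Definition partial_geometry (P L : finType) (I : P -> L -> bool)
    (s t alpha : nat) : Prop :=
  [/\ forall x y, x != y -> (#|[set l | I x l && I y l]| <= 1)%N,
      forall l, #|[set x | I x l]| = s.+1,
      forall x, #|[set l | I x l]| = t.+1
    & forall x l, ~~ I x l ->
        #|[set m | I x m && [exists y, I y m && I y l]]| = alpha].

Definition collinearity (P L : finType) (I : P -> L -> bool) : rel P :=
  fun x y => (x != y) && [exists l, I x l && I y l].

Definition from_partial_geometry (T : finType) (e : rel T) : Prop :=
  exists P L : finType, exists (I : P -> L -> bool) (s t alpha : nat),
    partial_geometry I s t alpha /\ graph_iso e (graph_compl (collinearity I)).

(* Main.v *)
(** Since |X| = 120 is congruent to 1 modulo 7, the 7-cycle on the positions
    3, ..., 9 fixes some spread S in X.  It leaves S_1 and S_2 invariant and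
    permutes S_3, ..., S_9 cyclically, so that S is determined by S_1, S_2 and
    S_3; a finite search leaves two possibilities for S, one in each system.
    As |X| = 120, X consists of the images of S under 120 explicit elements of
    G*, and its graph can be computed.

    In the graphs of Wallis and in the complements of those of Goethals and
    Seidel, the sets {a} x B are cocliques of size 8, and two of them are
    joined by two complete bipartite graphs.  But for each of the 24 cocliques C
    of size 8 through a fixed vertex of Gamma*, some vertex y outside C has
    fewer than 8 non-neighbours z outside C (with y itself counted) whose set
    of neighbours in C is that of y or its complement.

    In a partial geometry, s(t+1) = 63 and (t+1)alpha = 36 are the degree and
    the second intersection number of the collinearity graph; they force
    s >= 7, hence s = 7, since Gamma* has no coclique of size 9.  The lines through
    a vertex v then form a local spread: cocliques of size 8 that partition
    the 63 non-neighbours of v.  There is a coclique that belongs to every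
    local spread at one of its vertices and to no local spread at another. *)

Require Import Defs.
From Stdlib Require Import BinNat BinPos Nnat.
From Stdlib Require MSetPositive.
From mathcomp Require Import all_boot all_order all_algebra all_fingroup all_solvable.
From mathcomp Require Import finfield.

Set Implicit Arguments.
Unset Strict Implicit.
Unset Printing Implicit Defensive.

Import GRing.Theory Num.Theory.

(** * Partial geometries, fibrations of cocliques *)

Section DoubleCounting.

Lemma double_count (A B : finType) (R : A -> B -> bool) :
  \sum_a #|[set b | R a b]| = \sum_b #|[set a | R a b]|.
Proof.
under eq_bigr do rewrite -sum1dep_card big_mkcond.
rewrite exchange_big /=; apply: eq_bigr => b _.
by rewrite -sum1dep_card -big_mkcond.
Qed.

Lemma sum_card_bool (A : finType) (P : pred A) (F : A -> nat) :
  (forall a, F a = P a) -> \sum_a F a = #|[set a | P a]|.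
Proof.
by move=> FE; rewrite -sum1dep_card [RHS]big_mkcond; apply: eq_bigr.
Qed.

Lemma card_le1_exists (A : finType) (P : pred A) :
  #|[set a | P a]| <= 1 -> #|[set a | P a]| = [exists a, P a].
Proof.
case: existsP => [[a Pa]|nP] le1.
  by apply/eqP; rewrite eqn_leq le1; apply/card_gt0P; exists a; rewrite inE.
apply/eqP; rewrite cards_eq0; apply/eqP/setP=> a; rewrite !inE.
by apply/negP=> Pa; apply: nP; exists a.
Qed.

End DoubleCounting.

(** * Degree and intersection number of a collinearity graph *)

Section PartialGeometry.
Variables (P L : finType) (I : P -> L -> bool) (s t alpha : nat).
Hypothesis pgI : partial_geometry I s t alpha.

Lemma card_joining_lines x y :
  x != y -> #|[set l | I x l && I y l]| = collinearity I x y.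
Proof.
by case: pgI => le1 _ _ _ xy; rewrite card_le1_exists ?le1 // /collinearity xy.
Qed.

(** Count pairs (y, l) with l through x and y another point of l: each of the t+1 lines carries s
    such points, and each y collinear with x occurs once. *)
Lemma collinear_degree x : #|[set y | collinearity I x y]| = (t.+1 * s)%N.
Proof.
have [_ size_l deg_x _] := pgI.
rewrite -(sum_card_bool (F := fun y => #|[set l | [&& y != x, I x l & I y l]]|)); last first.
  move=> y; case: (eqVneq y x) => [->|yx] /=.
    by rewrite /collinearity eqxx /=; apply: eq_card0 => l; rewrite inE.
  by rewrite -card_joining_lines 1?eq_sym.
rewrite double_count (bigID (I x)) /= [X in _ + X]big1 ?addn0 => [|l /negPf nxl]; last first.
  by apply: eq_card0 => y; rewrite inE nxl /= andbF.
rewrite (eq_bigr (fun=> s)) => [|l xl].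
  by rewrite sum_nat_const -(deg_x x); congr (_ * _)%N; apply: eq_card => l; rewrite inE.
have := size_l l; rewrite (cardsD1 x) inE xl add1n => -[<-].
by apply: eq_card => y; rewrite !inE.
Qed.

(** Count pairs of a point y of l and a line m joining x to y. Such an m differs from l and so meets
    it in at most one point; the points thus correspond to the lines through x that meet l. *)
Lemma card_collinear_on_line x l :
  ~~ I x l -> #|[set y | collinearity I x y && I y l]| = alpha.
Proof.
have [le1 _ _ Ha] := pgI => nxl; rewrite -(Ha x l nxl).
rewrite -(sum_card_bool (F := fun y => #|[set m | [&& I y l, I x m & I y m]]|)); last first.
  move=> y; case yl: (I y l) => /=; rewrite ?andbF ?andbT.
    by rewrite card_joining_lines //; apply: contraNneq nxl => ->.
  by apply: eq_card0 => m; rewrite inE.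
rewrite double_count; apply: sum_card_bool => m.
case xm: (I x m) => /=; last by apply: eq_card0 => y; rewrite inE andbF.
rewrite -card_le1_exists.
  by apply: eq_card => y; rewrite !inE andbC.
rewrite leqNgt; apply/negP => /card_gt1P[y [z [yP zP yz]]].
move: yP zP; rewrite !inE => /andP[ym yl] /andP[zm zl].
have ml : m != l by apply: contraNneq nxl => <-.
have := le1 y z yz; rewrite leqNgt => /negP; apply.
by apply/card_gt1P; exists m, l; rewrite !inE ym yl zm zl.
Qed.

(** Each of the t+1 lines through x misses z and so carries alpha points collinear with z; every
    common neighbour lies on exactly one of these lines. *)
Lemma noncollinear_common_degree x z : x != z -> ~~ collinearity I x z ->
  #|[set y | collinearity I x y && collinearity I z y]| = (t.+1 * alpha)%N.
Proof.
have [_ _ deg_x _] := pgI => xz ncol.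
rewrite -(sum_card_bool (F := fun y =>
    #|[set l | [&& I x l, collinearity I z y & I y l]]|)); last first.
  move=> y; case zy: (collinearity I z y); rewrite ?andbF ?andbT /=; last first.
    by apply: eq_card0 => l; rewrite inE andbF.
  rewrite -card_joining_lines //; apply: contraNneq ncol => ->.
  move: zy; rewrite /collinearity eq_sym => /andP[-> /existsP[l]].
  by rewrite andbC => ?; apply/existsP; exists l.
rewrite double_count (bigID (I x)) /= [X in _ + X]big1 ?addn0 => [|l /negPf nxl]; last first.
  by apply: eq_card0 => y; rewrite inE nxl.
rewrite (eq_bigr (fun=> alpha)) => [|l xl].
  by rewrite sum_nat_const -(deg_x x); congr (_ * _)%N; apply: eq_card => l; rewrite inE.
rewrite -(@card_collinear_on_line z l); last first.
  apply: contra ncol => zl; rewrite /collinearity xz; apply/existsP; exists l.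
  by rewrite xl.
by apply: eq_card => y; rewrite !inE xl.
Qed.

End PartialGeometry.

Lemma partial_geometry_pullback (T P L : finType) (I : P -> L -> bool) s t alpha
    (f : T -> P) : bijective f -> partial_geometry I s t alpha ->
  partial_geometry (fun x => I (f x)) s t alpha.
Proof.
move=> bij_f [le1 size_l deg_x Ha]; split=> [x y xy|l|x|x l nxl].
- by apply: le1; rewrite (bij_eq bij_f).
- rewrite -(size_l l) -(on_card_preimset (f := f)); last by apply: onW_bij.
  by apply: eq_card => x; rewrite !inE.
- exact: deg_x.
- rewrite -(Ha _ _ nxl); apply: eq_card => m; rewrite !inE; congr (_ && _).
  have [g _ gK] := bij_f.
  apply/existsP/existsP=> -[y yP]; first by exists (f y).
  by exists (g y); rewrite gK.
Qed.

Lemma from_partial_geometryP (T : finType) (e : rel T) :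
  from_partial_geometry e ->
  exists (L : finType) (I : T -> L -> bool) (s t alpha : nat),
    partial_geometry I s t alpha /\
    forall x y, e x y = (x != y) && ~~ collinearity I x y.
Proof.
move=> [P [L [I [s [t [alpha [pgI [f bij_f fE]]]]]]]].
exists L, (fun x => I (f x)), s, t, alpha.
split; first exact: partial_geometry_pullback.
by move=> x y; rewrite -fE /graph_compl /collinearity (bij_eq bij_f).
Qed.

(* The last condition says that two fibres are joined by two disjoint (possibly
   degenerate) complete bipartite graphs covering both. *)
Definition bicoloured_fibration (T : finType) (e : rel T) : Prop :=
  exists (A : finType) (c : T -> A),
    [/\ forall x, #|[set y | c y == c x]| = 8,
        forall x y, c x = c y -> ~~ e x y
      & forall x x' y y', c x = c x' -> c y = c y' -> c x != c y ->
          e x y (+) e x y' = e x' y (+) e x' y'].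

(** * Fibrations in the graphs of Wallis and of Goethals and Seidel *)

Lemma card_fst (A B : finType) (a : A) : #|[set u : A * B | u.1 == a]| = #|B|.
Proof.
rewrite -[RHS]mul1n -(cards1 a) -cardsT -cardsX; apply: eq_card => -[b x].
by rewrite !inE andbT.
Qed.

(** [g] and [h] two-colour the fibres over [a] and [b], adjacency meaning equal colours. The size of
    [B] may be derived from a point of [A], because Wallis data give it through the design at such a
    point. *)
Lemma fibration_pullback (T A B : finType) (e : rel T) (e' : rel (A * B)) :
    graph_iso e e' -> (A -> #|B| = 8) ->
    (forall u v, u.1 = v.1 -> ~~ e' u v) ->
    (forall a b, a != b -> exists (g h : B -> bool),
       forall x y, e' (a, x) (b, y) = (g x == h y)) ->
  bicoloured_fibration e.
Proof.
move=> [f bij_f fE] cardB coc joins; exists A, (fun x => (f x).1); split=> [x|x y fxy|].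
- rewrite -(cardB (f x).1) -(card_fst B (f x).1).
  rewrite -(on_card_preimset (f := f)); last exact: onW_bij.
  by apply: eq_card => y; rewrite !inE.
- by rewrite -fE coc.
- move=> x x' y y'; rewrite -!fE.
  case: (f x) (f x') (f y) (f y') => [a u] [a' u'] [b v] [b' v'] /= <- <- /joins.
  move=> [g [h E]]; rewrite !E.
  by case: (g u); case: (g u'); case: (h v); case: (h v').
Qed.

Lemma design_block_through (A : finType) v k (L : {set {set A}}) (a b : A) :
  design2 v k 1 L -> a != b ->
  exists2 l, [&& l \in L, a \in l & b \in l] &
    forall m, [&& m \in L, a \in m & b \in m] -> m = l.
Proof.
case=> _ _ lam ab; have /eqP/cards1P[l lE] := lam a b ab.
have memE m : [&& m \in L, a \in m & b \in m] = (m == l).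
  by have := in_set1 m l; rewrite -lE inE.
by exists l; [rewrite memE|move=> m; rewrite memE => /eqP].
Qed.

(** The unique block on two base points supplies both colourings: a vertex gets the label of the
    4-set containing it in the parallel class assigned to that block. *)
Lemma from_Wallis_fibration (T : finType) (e : rel T) :
  from_Wallis e -> bicoloured_fibration e.
Proof.
move=> [A [B [L [cls [lab [[desL affine] iso_e]]]]]].
apply: fibration_pullback iso_e _ _ _.
- by move=> a; have [D [R [[cardB _ _] _ _ _ _]]] := affine a.
- by move=> u v uv; rewrite /Wallis_adj uv eqxx.
move=> a b ab; have [l lP l_uniq] := design_block_through desL ab.
exists (fun x => lab a l (pblock (cls a l) x)), (fun y => lab b l (pblock (cls b l) y)).
move=> x y; rewrite /Wallis_adj ab /=; apply/existsP/idP => [[m]|E].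
  by case/and4P=> mL am bm; rewrite (l_uniq m) ?mL ?am.
by exists l; move: lP => /and3P[-> -> ->].
Qed.

(** Count pairs (b, l) with b different from a and both in l: each of the 14 other points shares one
    block with a, and each block through a has two further points. *)
Lemma design_degree (A : finType) (L : {set {set A}}) (a : A) :
  design2 15 3 1 L -> #|blocks_at L a| = 7.
Proof.
move=> [cardA sizeL lam].
have := double_count (fun (b : A) (l : {set A}) => [&& b != a, l \in L, a \in l & b \in l]).
rewrite (bigD1 a) //= [X in X + _]eq_card0 ?add0n => [|l]; last by rewrite inE eqxx.
rewrite (eq_bigr (fun=> 1)) => [|b ba]; last first.
  rewrite eq_sym in ba.
  by rewrite -(lam a b ba); apply: eq_card => l; rewrite !inE eq_sym ba.
rewrite sum1_card (_ : #|_| = 14); last first.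
  have := cardA; rewrite -cardsT (cardsD1 a) inE => -[<-].
  by apply: eq_card => b; rewrite !inE andbT.
rewrite (bigID (mem (blocks_at L a))) /= [X in _ + X]big1 ?addn0 => [|l]; last first.
  rewrite inE => /nandP nl; apply: eq_card0 => b; rewrite !inE.
  by apply/negP=> /and4P[_ lL al _]; case: nl => /negP.
rewrite (eq_bigr (fun=> 2)) => [|l]; last first.
  rewrite inE => /andP[lL al]; have := sizeL l lL; rewrite (cardsD1 a) al => -[<-].
  by apply: eq_card => b; rewrite !inE lL.
by rewrite sum_nat_const => E; apply/eqP; rewrite -(eqn_pmul2r (isT : 0 < 2)) -E.
Qed.

(** Inside a fibre every column but [j0] occurs, so orthogonality of two rows of [H] leaves the
    inner product -1, which is adjacency before complementation. Across fibres a single block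
    contributes, and the sign of its term tells whether the two entries agree. *)
Lemma from_GS_compl_fibration (T : finType) (e : rel T) :
  from_GS_compl e -> bicoloured_fibration e.
Proof.
move=> [A [L [H [j0 [col [[desL [entH HHt] H0 col_inj col_ne] iso_e]]]]]].
have degL a := design_degree a desL.
apply: fibration_pullback iso_e _ _ _; first by move=> _; rewrite card_ord.
- move=> [a x] [b y] /= <-; rewrite /graph_compl xpair_eqE eqxx /=.
  case: eqVneq => //= xy; rewrite negbK /GS_adj xpair_eqE eqxx xy /=.
  (* Seven distinct columns avoiding [j0] are all the other columns. *)
  have imE : col a @: blocks_at L a = [set~ j0].
    apply/eqP; rewrite eqEcard cardsC1 card_ord card_in_imset ?degL // andbT.
    by apply/subsetP=> _ /imsetP[l la ->]; rewrite !inE col_ne.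
  have -> : (\sum_(l in L) GS_matrix H col (a, x) l * GS_matrix H col (a, y) l
      = \sum_(j in [set~ j0]) H x j * H y j)%R.
    rewrite -imE big_imset //= [LHS](bigID (mem (blocks_at L a))) /=.
    rewrite [X in (_ + X)%R]big1 ?addr0.
      apply: eq_big => [l|l]; rewrite !inE; first by case: (l \in L).
      by rewrite /GS_matrix /=; case/and3P=> _ _ ->.
    move=> l; rewrite inE /GS_matrix /= => /andP[-> /=].
    by case: (a \in l) => //; rewrite mul0r.
  have := congr1 (fun M : 'M_8 => M x y) HHt; rewrite !mxE (negPf xy) mulr0n.
  rewrite (bigD1 j0) //= mxE !H0 mulr1 => /eqP; rewrite addrC addr_eq0 => /eqP <-.
  by apply/eqP; apply: eq_big => j; rewrite ?inE // mxE.
- move=> a b ab; have [l lP l_uniq] := design_block_through desL ab.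
  exists (fun x => H x (col a l) == 1%R), (fun y => H y (col b l) == 1%R) => x y.
  rewrite /graph_compl /GS_adj xpair_eqE (negPf ab) /=.
  have /and3P[lL al bl] := lP.
  rewrite (bigD1 l) //= big1 ?addr0 => [|m /andP[mL ml]]; last first.
    rewrite /GS_matrix /=; case: ifP => am; last by rewrite mul0r.
    case: ifP => bm; last by rewrite mulr0.
    by rewrite (l_uniq m) ?mL ?am ?eqxx // in ml.
  rewrite /GS_matrix /= al bl.
  by case: (entH x (col a l)) => ->; case: (entH y (col b l)) => ->.
Qed.

(** * Certificates on a finite graph *)

Section CliqueEnumeration.
Variable T : eqType.

Fixpoint cliques (r : rel T) (k : nat) (c : seq T) : seq (seq T) :=
  if k is k'.+1 then
    (fix from c := if c is x :: c' then
        map (cons x) (cliques r k' (filter (r x) c')) ++ from c'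
      else [::]) c
  else [:: [::]].

Lemma mem_cliques (r : rel T) s c :
  subseq s c -> pairwise r s -> s \in cliques r (size s) c.
Proof.
elim: s c => [|x s IHs] c; first by rewrite inE.
elim: c => //= y c IHc; case: eqVneq => [<-|_] sub_s /andP[rs pw_s].
  by rewrite mem_cat map_f // IHs // subseq_filter rs.
by rewrite mem_cat IHc ?orbT //= rs.
Qed.

(* Running out of fuel counts as success, so that only the value false is
   conclusive.  The test is not written with &&, both arguments of which
   vm_compute would evaluate. *)
Fixpoint partial_spread_cover (fuel : nat) (lines : seq (seq T)) (todo : seq T) :=
  if todo is p :: _ then
    if fuel is k.+1 then
      has (fun l => if p \in l then partial_spread_cover k
               [seq m <- lines | ~~ has (mem l) m] [seq q <- todo | q \notin l]
             else false) lines
    else true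
  else true.

(** [F] singles out the lines of an actual partition, and the search can follow it: the [F]-line
    through the first open point is disjoint from the [F]-lines of the points that stay open, so
    none of those is discarded. *)
Lemma partial_spread_coverP (F : seq T -> Prop) fuel lines todo :
    (forall l m, F l -> F m -> l = m \/ ~~ has (mem l) m) ->
    (forall p, p \in todo -> exists l, [/\ F l, l \in lines & p \in l]) ->
  partial_spread_cover fuel lines todo.
Proof.
move=> F_disj; elim: fuel lines todo => [|k IHk] lines [|p todo] //= F_cov.
have [l [Fl l_in pl]] := F_cov p (mem_head _ _).
apply/hasP; exists l => //; rewrite pl; apply: IHk => q.
rewrite mem_filter => /andP[nql q_todo].
have [m [Fm m_in qm]] := F_cov q (mem_behead (s := p :: todo) q_todo).
exists m; split=> //; rewrite mem_filter m_in andbT.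
by case: (F_disj l m Fl Fm) => // lm; rewrite lm qm in nql.
Qed.

End CliqueEnumeration.

Section Certificates.
Variables (n : nat) (e : rel 'I_n.+1) (r : rel nat).
Hypothesis eE : forall i j : 'I_n.+1, e i j = r i j.

Definition nonadjacent (i j : nat) := (i != j) && ~~ r i j.
Definition conbrs (v : nat) := [seq j <- iota 0 n.+1 | nonadjacent v j].

Definition others (v : nat) (p : pred nat) := [seq j <- iota 0 n.+1 | p j && (j != v)].

Definition members (D : {set 'I_n.+1}) : pred nat := [in [seq val i | i <- enum D]].

Lemma mem_members (D : {set 'I_n.+1}) (i : 'I_n.+1) : members D (val i) = (i \in D).
Proof. by rewrite /members /= mem_map ?mem_enum //; apply: val_inj. Qed.

Lemma mem_others v (D : {set 'I_n.+1}) (i : 'I_n.+1) :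
  (val i \in others v (members D)) = (i \in D) && (val i != v).
Proof. by rewrite mem_filter mem_members mem_iota add0n ltn_ord leq0n !andbT. Qed.

Lemma others_ord v (D : {set 'I_n.+1}) j : j \in others v (members D) ->
  exists i : 'I_n.+1, [/\ j = val i, i \in D & val i != v].
Proof.
move=> jD; have : j < n.+1 by move: jD; rewrite mem_filter mem_iota add0n => /and3P[].
move=> lt_j; exists (Ordinal lt_j).
by have := jD; rewrite -[j]/(val (Ordinal lt_j)) mem_others => /andP[].
Qed.

Lemma count_iota (p : pred nat) : count p (iota 0 n.+1) = #|[set i : 'I_n.+1 | p i]|.
Proof.
by rewrite -val_enum_ord count_map -sum1_count big_enum_cond -sum1dep_card.
Qed.

Lemma size_others (v : 'I_n.+1) (D : {set 'I_n.+1}) :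
  v \in D -> size (others v (members D)) = #|D|.-1.
Proof.
move=> Dv; rewrite size_filter count_iota (cardsD1 v D) Dv.
by apply: eq_card => i; rewrite !inE mem_members (inj_eq val_inj) andbC.
Qed.

(** Listed in increasing order, a coclique through [v] without [v] has the form that
    [cliques nonadjacent] enumerates. *)
Lemma coclique_others (v : 'I_n.+1) (D : {set 'I_n.+1}) :
    v \in D -> {in D &, forall x y, ~~ e x y} ->
  subseq (others v (members D)) (conbrs v) /\ pairwise nonadjacent (others v (members D)).
Proof.
move=> Dv cocl; split.
  rewrite subseq_filter filter_subseq andbT; apply/allP=> j /others_ord[i [-> iD iv]].
  by rewrite /nonadjacent -eE cocl // andbT eq_sym.
have := iota_uniq 0 n.+1 => /(filter_uniq (fun j => members D j && (j != v))).
rewrite uniq_pairwise; apply: (@sub_in_pairwise _ [in others v (members D)]); last first.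
  by apply/allP.
move=> i0 j0 /others_ord[i [-> iD _]] /others_ord[j [-> jD _]] ij.
by rewrite /nonadjacent -eE cocl // andbT.
Qed.

(** [pattern z] is the adjacency vector of [z] on [C], complemented if necessary so as to vanish at
    vertex 0; thus a set of neighbours and its complement have the same pattern. *)
Definition fibration_obstruction :=
  all (fun s => let C := 0 :: s in
    let pattern z := [seq r x z (+) r 0 z | x <- C] in
    let zs := [seq (z, pattern z) | z <- iota 0 n.+1 & z \notin C] in
    has (fun y => let p := pattern y in
          count (fun zp => ~~ r y zp.1 && (zp.2 == p)) zs < 8)
      [seq y <- conbrs 0 | y \notin C])
    (cliques nonadjacent 7 (conbrs 0)).

(** Take for [C] the fibre of vertex 0. The fibre of the witness [y] consists of eight
    non-neighbours of [y], itself included, that all have the pattern of [y]. *)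
Lemma no_bicoloured_fibration :
  fibration_obstruction -> ~ bicoloured_fibration e.
Proof.
move=> obs [A [c [card_c cocl joins]]].
pose C := [set y | c y == c ord0].
have C0 : ord0 \in C by rewrite inE.
pose s := others (@ord0 n) (members C).
have memC (z : 'I_n.+1) : (val z \in 0 :: s) = (c z == c ord0).
  rewrite in_cons mem_others inE -[0]/(val (@ord0 n)) (inj_eq val_inj).
  by case: eqVneq => //= [->|_]; rewrite ?eqxx ?andbT.
have [subC pwC] : subseq s (conbrs 0) /\ pairwise nonadjacent s.
  apply: (@coclique_others ord0) => // x y; rewrite !inE => /eqP xc /eqP yc.
  by rewrite cocl // xc.
have := mem_cliques subC pwC; rewrite (@size_others ord0) // card_c => C_in.
have /hasP[y0] := allP obs _ C_in.
rewrite mem_filter => /andP[y0C]; rewrite mem_filter mem_iota add0n => /and3P[_ _ lt_y0].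
pose y := Ordinal lt_y0; cbv zeta; rewrite ltnNge => /negP; apply.
rewrite count_map count_filter -size_filter -(card_c y) cardE -(size_map val).
apply: uniq_leq_size.
  by rewrite map_inj_uniq ?enum_uniq //; apply: val_inj.
move=> j /mapP[z]; rewrite mem_enum inE => /eqP zy ->.
have cy0 : c ord0 != c y by rewrite eq_sym -memC.
rewrite mem_filter mem_iota add0n ltn_ord leq0n !andbT; apply/andP; split; last first.
  by rewrite memC zy eq_sym.
apply/andP; split; first by rewrite -[y0]/(val y) -eE cocl.
apply/eqP/eq_in_map=> x0 x0C.
have lt_x0 : x0 < n.+1.
  by move: x0C; rewrite in_cons => /predU1P[->|/others_ord[i [-> _ _]]] //; apply: ltn_ord.
have := x0C; rewrite -[x0]/(val (Ordinal lt_x0)) memC => /eqP cx.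
(* The bicolouring at vertices 0 and [x0] of [C] is equality of the patterns of [y] and [z] at [x0],
   up to rearranging the sum. *)
have := joins ord0 (Ordinal lt_x0) y z; rewrite !eE /= cx zy => /(_ erefl erefl cy0).
by case: (r 0 y0); case: (r 0 z); case: (r x0 y0); case: (r x0 z).
Qed.

Definition lines8 (v : nat) := cliques nonadjacent 7 (conbrs v).

(* A coclique that every local spread at 0 contains, although no local spread
   at one of its other vertices does. *)
Definition forced_line :=
  let c8 := lines8 0 in
  nth [::] c8 (find (fun s => ~~ partial_spread_cover 9 (filter (predC1 s) c8) (conbrs 0)) c8).

(** The coclique [0 :: s] is already one line at [v]; a local spread containing it has eight more,
    whence the fuel. *)
Definition line_excluded (s : seq nat) (v : nat) :=
  let m := others v [in 0 :: s] in
  ~~ partial_spread_cover 8 [seq l <- lines8 v | ~~ has [in m] l]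
                            [seq q <- conbrs v | q \notin m].

(** What the two uses of [find] are meant to deliver is tested again here, so a default value
    returned by [nth] after a failed search cannot pass. *)
Definition geometry_obstruction :=
  let s := forced_line in
  let v := nth 0 s (find (line_excluded s) s) in
  [&& size (conbrs 0) == 63,
      has (fun q => r 0 q && (count (nonadjacent q) (conbrs 0) == 36)) (iota 0 n.+1),
      cliques nonadjacent 8 (conbrs 0) == [::],
      ~~ partial_spread_cover 9 (filter (predC1 s) (lines8 0)) (conbrs 0)
    & (v \in s) && line_excluded s v].

Lemma no_partial_geometry :
  irreflexive e -> geometry_obstruction -> ~ from_partial_geometry e.
Proof.
move=> irr_e /and5P[/eqP deg0 /hasP[q0 + /andP[adj_q /eqP mu0]] /eqP no9 /negP forced].
rewrite mem_iota add0n; set s := forced_line; set v0 := nth 0 s _.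
move=> /andP[_ lt_q] /andP[v0_in excluded].
pose q := Ordinal lt_q.
move=> /from_partial_geometryP[L [I [s0 [t [alpha [pgI eI]]]]]].
have colE i j : collinearity I i j = nonadjacent i j.
  rewrite /nonadjacent -eE eI; rewrite /collinearity (inj_eq val_inj).
  by case: eqVneq => //= _; rewrite negbK.
have deg : (t.+1 * s0 = 63)%N.
  rewrite -(collinear_degree pgI ord0) -deg0 size_filter count_iota.
  by apply: eq_card => i; rewrite !inE colE.
have mu : (t.+1 * alpha = 36)%N.
  rewrite -(@noncollinear_common_degree _ _ _ _ _ _ pgI ord0 q).
  - rewrite -mu0 count_filter count_iota.
    by apply: eq_card => i; rewrite !inE !colE andbC.
  - by apply: contraTneq adj_q => q_0; rewrite -[q0]/(val q) -(eE ord0) q_0 irr_e.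
  - by rewrite colE /nonadjacent adj_q andbF.
(* t+1 divides gcd(63, 36) = 9, and s at most 6 would then give a degree of at most 54. *)
have s0_ge7 : 7 <= s0.
  have t_le : t.+1 <= 9.
    by apply: dvdn_leq; rewrite // -[9]/(gcdn 63 36) dvdn_gcd -{1}deg -mu !dvdn_mulr.
  rewrite leqNgt; apply/negP => s_lt.
  by have := leq_mul t_le (s_lt : s0 <= 6); rewrite deg.
pose D l := [set x | I x l].
pose tail v l := others v (members (D l)).
have [le1 size_l deg_x _] := pgI.
have cocl l : {in D l &, forall x y, ~~ e x y}.
  move=> x y; rewrite !inE eI /collinearity => xl yl; case: eqVneq => //= _.
  by rewrite negbK; apply/existsP; exists l; rewrite xl.
have coclP (v : 'I_n.+1) l : I v l ->
    subseq (tail v l) (conbrs v) /\ pairwise nonadjacent (tail v l).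
  by move=> vl; apply: coclique_others; rewrite ?inE //; apply: cocl.
have size_tail (v : 'I_n.+1) l : I v l -> size (tail v l) = s0.
  by move=> vl; rewrite size_others ?inE // size_l.
have s07 : s0 = 7.
  have [l0 l0P] : exists l, I ord0 l.
    have /card_gt0P[l] : 0 < #|[set l | I ord0 l]| by rewrite deg_x.
    by rewrite inE; exists l.
  apply/eqP; rewrite eqn_leq s0_ge7 andbT leqNgt; apply/negP=> s_gt7.
  have [sub pw] := coclP _ _ l0P.
  (* Eight further points of a line with s > 7 would form, with vertex 0, a coclique of size 9. *)
  have sz : size (take 8 (tail (@ord0 n) l0)) = 8 by rewrite size_takel // size_tail.
  have := mem_cliques (subseq_trans (take_subseq _ 8) sub)
                      (subseq_pairwise (take_subseq _ 8) pw).
  by rewrite sz no9.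
have tail_in (v : 'I_n.+1) l : I v l -> tail v l \in lines8 v.
  move=> vl; have [sub pw] := coclP _ _ vl.
  by have := mem_cliques sub pw; rewrite size_tail // s07.
have disj (v : 'I_n.+1) l m : I v l -> I v m -> l != m -> ~~ has [in tail v l] (tail v m).
  move=> vl vm lm; apply/hasPn=> _ /others_ord[i [-> im iv]].
  rewrite mem_others iv andbT; move: im; rewrite !inE => im; apply/negP=> il.
  have iv' : i != v by rewrite -(inj_eq val_inj).
  have := le1 i v iv'; rewrite leqNgt => /negP; apply.
  by apply/card_gt1P; exists l, m; rewrite !inE il im vl vm.
have line_through (v : 'I_n.+1) j : j \in conbrs v -> exists2 l, I v l & j \in tail v l.
  rewrite mem_filter mem_iota add0n => /and3P[vj _ lt_j]; pose i := Ordinal lt_j.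
  have : collinearity I v i by rewrite colE.
  case/andP=> iv /existsP[l /andP[vl il]]; exists l => //.
  by rewrite -[j]/(val i) mem_others inE il eq_sym (inj_eq val_inj).
(* If the forced coclique is not a line through vertex 0, the lines through 0 form a local spread
   avoiding it, contrary to [forced]. *)
case: (pickP (fun l => I ord0 l && (tail (@ord0 n) l == s))) => [l1|no_line]; last first.
  pose F m := exists2 l, I ord0 l & m = tail (@ord0 n) l.
  apply: forced; apply: (@partial_spread_coverP _ F).
    move=> _ _ [l l_0 ->] [m m_0 ->]; case: (eqVneq l m) => [->|lm]; [by left|right].
    exact: disj.
  move=> j /(line_through (@ord0 n))[l l_0 jl].
  exists (tail (@ord0 n) l); split=> //; first by exists l.
  rewrite mem_filter (tail_in (@ord0 n)) // andbT /=.
  by have := no_line l; rewrite l_0 /= => ->.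
case/andP=> l1_0 /eqP l1E.
have [v [v0E vD _]] : exists i : 'I_n.+1, [/\ v0 = val i, i \in D l1 & val i != 0].
  by apply: others_ord; rewrite -/(tail 0 l1) l1E.
have v_l1 : I v l1 by rewrite inE in vD.
(* The same line seen from its point [v]: vertex 0 comes back and [v] is left out. *)
have tail_v : others v [in 0 :: s] = tail v l1.
  apply: eq_in_filter => j; rewrite mem_iota add0n => /andP[_ lt_j]; congr (_ && _).
  pose i := Ordinal lt_j; transitivity (val i \in 0 :: s); first by [].
  rewrite -[j]/(val i) mem_members in_cons -l1E mem_others.
  rewrite inE -[0]/(val (@ord0 n)) (inj_eq val_inj).
  by case: eqVneq => [->|_]; rewrite ?andbT ?l1_0.
move: excluded; rewrite v0E /line_excluded tail_v => /negP; apply.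
(* The other lines through [v] complete this line to a local spread at [v], which [excluded]
   forbids. *)
apply: (@partial_spread_coverP _ (fun m => exists2 l, I v l & m = tail v l)).
  move=> _ _ [l l_0 ->] [m m_0 ->]; case: (eqVneq l m) => [->|lm]; [by left|right].
  exact: disj.
move=> j; rewrite mem_filter => /andP[njl1 /line_through[l vl jl]].
exists (tail v l); split=> //; first by exists l.
rewrite mem_filter tail_in // andbT; apply: disj => //.
by apply: contraNneq njl1 => ->.
Qed.

End Certificates.

(** * Binary codes of vectors *)

Definition bit (n : N) (i : nat) : bool := N.testbit n (N.of_nat i).

Definition enc (s : seq bool) : N :=
  foldr (fun b n => if b then N.succ_double n else N.double n) N0 s.

Lemma bit_enc s i : bit (enc s) i = nth false s i.
Proof.
elim: s i => [|b s IHs] [|i]; rewrite ?nth_nil //.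
  by rewrite /bit /=; case: b; case: (enc s).
rewrite -[RHS]IHs /bit Nat2N.inj_succ [enc _]/=; case: b.
  by rewrite N.succ_double_spec N.testbit_odd_succ //; apply: N.le_0_l.
by rewrite N.double_spec N.testbit_even_succ //; apply: N.le_0_l.
Qed.

Lemma bit_inj m n : (forall i, bit m i = bit n i) -> m = n.
Proof. by move=> E; apply: N.bits_inj => i; rewrite -(N2Nat.id i); apply: E. Qed.

Lemma bit_xor m n i : bit (N.lxor m n) i = bit m i (+) bit n i.
Proof. by rewrite /bit N.lxor_spec; do 2!case: N.testbit. Qed.

Lemma enc_lt s : N.to_nat (enc s) < 2 ^ size s.
Proof.
elim: s => //= b s IHs; rewrite expnS.
have -> : N.to_nat (if b then N.succ_double (enc s) else N.double (enc s))
    = (b + 2 * N.to_nat (enc s))%N.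
  by case: b; rewrite ?N2Nat.inj_succ_double ?N2Nat.inj_double ?add1n.
by case: b; rewrite ?add0n ?ltn_pmul2l //= ?mul2n ?add1n ?ltn_Sdouble ?ltn_double.
Qed.

Definition codes : seq N := [seq N.of_nat i | i <- iota 0 512].

Lemma enc_code s : size s <= 9 -> enc s \in codes.
Proof.
move=> size_s; apply/mapP; exists (N.to_nat (enc s)); last by rewrite N2Nat.id.
rewrite mem_iota /= add0n (leq_trans (enc_lt s)) //.
by rewrite -[512]/(2 ^ 9) leq_exp2l.
Qed.

Definition vec_of (n : N) : vec := (\row_i (bit n i)%:R)%R.

Definition code (x : vec) : N := enc [seq x 0%R i != 0%R | i <- enum 'I_9].

Lemma bit_code x (i : 'I_9) : bit (code x) i = (x 0%R i != 0%R).
Proof. by rewrite bit_enc (nth_map i) ?size_enum_ord // nth_ord_enum. Qed.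

Lemma bit_code_ge x i : 9 <= i -> bit (code x) i = false.
Proof. by move=> i9; rewrite bit_enc nth_default // size_map size_enum_ord. Qed.

Lemma code_in x : code x \in codes.
Proof. by rewrite enc_code // size_map size_enum_ord. Qed.

Lemma F2_neq0 (a : 'F_2) : a = ((a != 0)%:R)%R.
Proof. by case: a => -[|[|m]] lt_m //; apply/val_inj. Qed.

Lemma F2_nat (m : nat) : (m%:R == 0 :> 'F_2)%R = ~~ odd m.
Proof. by rewrite -(dvdn_pcharf (pchar_Fp (isT : prime 2))) dvdn2. Qed.

Lemma codeK : cancel code vec_of.
Proof. by move=> x; apply/rowP=> i; rewrite mxE bit_code -F2_neq0. Qed.

Lemma code_inj : injective code. Proof. exact: can_inj codeK. Qed.

Lemma vec_ofK : {in codes, cancel vec_of code}.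
Proof.
have chk : all (fun n => enc [seq bit n i | i <- iota 0 9] == n) codes by vm_compute.
move=> n /(allP chk)/eqP E; rewrite -[RHS]E /code -val_enum_ord -map_comp.
congr enc; apply: eq_map => i /=; rewrite mxE.
by case: bit; rewrite ?oner_eq0 ?eqxx.
Qed.

Lemma code_add x y : code (x + y)%R = N.lxor (code x) (code y).
Proof.
apply: bit_inj => i; rewrite bit_xor; case: (ltnP i 9) => [lt_i|ge_i].
  rewrite -[i]/(val (Ordinal lt_i)) !bit_code mxE.
  rewrite {1}(F2_neq0 (x _ _)) {1}(F2_neq0 (y _ _)).
  by case: (x _ _ != _)%R; case: (y _ _ != _)%R.
by rewrite !bit_code_ge.
Qed.

Lemma code0 : code 0%R = 0%num.
Proof.
apply: bit_inj => i; rewrite [RHS]N.bits_0; case: (ltnP i 9) => [lt_i|/bit_code_ge->//].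
by rewrite -[i]/(val (Ordinal lt_i)) bit_code mxE eqxx.
Qed.

Lemma code_eq0 x : (code x == 0%num) = (x == 0%R).
Proof. by rewrite -code0 (inj_eq code_inj). Qed.

Fixpoint popcount (p : positive) : nat :=
  match p with
  | xH => 1 | xO p => popcount p | xI p => (popcount p).+1
  end.

(* The singular vectors are the even-weight ones of weight 4 or 8, since
   the form takes the value C(w, 2) on vectors of weight w. *)
Definition singular (n : N) : bool :=
  if n is Npos p then popcount p \in [:: 4; 8] else false.

Lemma sum_ord_sumn n (F : nat -> nat) :
  \sum_(i < n) F i = sumn [seq F i | i <- iota 0 n].
Proof. by rewrite -(big_mkord xpredT F) sumnE big_map /index_iota subn0. Qed.

Lemma quadricE x : (x \in quadric) = singular (code x).
Proof.
(* [S1] and [S2] lift the coordinate sum and the quadratic form to natural numbers, whose parities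
   decide whether the values in F_2 vanish. *)
pose S1 n := sumn [seq bit n i : nat | i <- iota 0 9].
pose S2 n := sumn [seq sumn [seq if i < j then bit n i && bit n j : nat else 0
                            | j <- iota 0 9] | i <- iota 0 9].
have chk : all (fun n => singular n == [&& n != 0%num, ~~ odd (S1 n) & ~~ odd (S2 n)]) codes.
  by vm_compute.
rewrite (eqP (allP chk _ (code_in x))) inE code_eq0; congr [&& _, _ & _].
  rewrite /in_V -F2_nat /S1 -sum_ord_sumn natr_sum; congr (_ == _).
  by apply: eq_bigr => i _; rewrite bit_code -F2_neq0.
rewrite /qform -F2_nat /S2 -sum_ord_sumn natr_sum; congr (_ == _).
apply: eq_bigr => i _; rewrite -sum_ord_sumn natr_sum.
rewrite big_mkcond; apply: eq_bigr => j _; case: ifP => // _.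
rewrite !bit_code {1}(F2_neq0 (x _ i)) {1}(F2_neq0 (x _ j)) -natrM.
by case: (_ != _); case: (_ != _).
Qed.

Definition quadric_codes : seq N := [seq n <- codes | singular n].

Lemma mem_quadric_codes x : (code x \in quadric_codes) = (x \in quadric).
Proof. by rewrite mem_filter code_in andbT quadricE. Qed.

(** * Totally isotropic subspaces *)

Definition sum_closed (P : {set vec}) : Prop :=
  {in P &, forall x y, x + y != 0 -> x + y \in P}%R.

Lemma F2_cases (a : 'F_2) : a = 0%R \/ a = 1%R.
Proof. by rewrite (F2_neq0 a); case: (a != 0)%R; [right|left]. Qed.

(** The only scalars are 0 and 1, so linear combinations are plain sums and closure under nonzero
    sums suffices. *)
Lemma mem_span_closed (P : {set vec}) (s : seq vec) v :
  sum_closed P -> {subset s <= P} -> v \in <<s>>%VS -> v = 0%R \/ v \in P.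
Proof.
move=> cloP; elim: s v => [|u s IHs] v sP.
  by rewrite span_nil memv0 => /eqP ->; left.
rewrite span_cons => /memv_addP[_ /vlineP[k ->] [w w_s ->]].
have {IHs} wP : w = 0%R \/ w \in P.
  by apply: IHs w_s => z z_s; rewrite sP // in_cons z_s orbT.
have uP : u \in P by rewrite sP ?mem_head.
case: (F2_cases k) => ->; rewrite ?scale0r ?add0r // scale1r.
case: wP => [->|wP]; first by rewrite addr0; right.
by case: (eqVneq (u + w)%R 0%R) => [|uw]; [left|right; apply: cloP].
Qed.

Lemma proj_subspaceP (P : {set vec}) :
  reflect (0%R \notin P /\ sum_closed P) (proj_subspace P).
Proof.
apply: (iffP eqP) => [E|[P0 cloP]].
  split; first by rewrite E inE eqxx andbF.
  move=> x y; rewrite E !inE => /andP[xP _] /andP[yP _] ->.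
  by rewrite andbT memvD.
apply/setP=> v; rewrite inE; apply/idP/andP => [vP|[v_span v0]].
  split; last by apply: contraNneq P0 => <-.
  by apply: memv_span; rewrite mem_enum.
have sub_enum : {subset enum P <= P} by move=> z; rewrite mem_enum.
by case: (mem_span_closed cloP sub_enum v_span) v0 => [->|//]; rewrite eqxx.
Qed.

Lemma card_proj_subspace (P : {set vec}) :
  proj_subspace P -> #|P|.+1 = (2 ^ \dim (pspan P))%N.
Proof.
move/eqP=> PE; have := card_vspace (pspan P); rewrite card_Fp // => <-.
have nP0 : 0%R \notin P by rewrite PE inE eqxx andbF.
transitivity #|0%R |: P|; first by rewrite cardsU1 nP0.
apply: eq_card => x; rewrite in_setU1 [in LHS]PE inE.
by case: eqVneq => [->|_]; rewrite ?andbT //; apply/esym/mem0v.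
Qed.

(** The vector-space dimension d of a projective subspace with [n] points, because it has 2^d - 1 of
    them. *)
Definition ldim (n : nat) : nat := trunc_log 2 n.+1.

Lemma pdimE (P : {set vec}) : proj_subspace P -> pdim P = ((ldim #|P|)%:Z - 1)%R.
Proof. by move=> /card_proj_subspace PE; rewrite /pdim /ldim PE trunc_expnK. Qed.

Lemma proj_subspaceI (P R : {set vec}) :
  proj_subspace P -> proj_subspace R -> proj_subspace (P :&: R).
Proof.
move=> /proj_subspaceP[P0 cloP] /proj_subspaceP[_ cloR]; apply/proj_subspaceP.
split=> [|x y]; first by rewrite inE (negPf P0).
by rewrite !inE => /andP[xP xR] /andP[yP yR] xy; rewrite cloP ?cloR.
Qed.

Lemma addvv (x : vec) : (x + x = 0)%R.
Proof. by apply/code_inj; rewrite code_add code0 N.lxor_nilpotent. Qed.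

Lemma addv_eq0 (x y : vec) : (x + y == 0)%R = (x == y).
Proof. by rewrite addr_eq0; have /eqP := addvv y; rewrite addr_eq0 => /eqP <-. Qed.

Section Generator.
Variable P : {set vec}.
Hypothesis genP : P \in generators.

Lemma generator_isotropic : totally_isotropic P.
Proof. by move: genP; rewrite inE => /maxsetp. Qed.

Lemma generator_subspace : proj_subspace P.
Proof. by case/andP: generator_isotropic. Qed.

Lemma generator_quadric : P \subset quadric.
Proof. by case/andP: generator_isotropic. Qed.

Lemma generator_closed : sum_closed P.
Proof. by case/proj_subspaceP: generator_subspace. Qed.

(* Otherwise P and z would span a larger totally isotropic subspace. *)
Lemma generator_maximal z : z \in quadric ->
  {in P, forall x, x != z -> (x + z)%R \in quadric} -> z \in P.
Proof.
move=> zQ perp; apply: contraT => nzP.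
pose R := [set x | [|| x \in P, x == z | (x + z)%R \in P]].
have [P0 cloP] := proj_subspaceP _ generator_subspace.
have addKz x : (x + z + z = x)%R by rewrite -addrA addvv addr0.
have tiR : totally_isotropic R.
  apply/andP; split.
    apply/proj_subspaceP; split=> [|x y].
      rewrite inE (negPf P0) add0r (negPf nzP) orbF /= eq_sym.
      by apply: contraTneq zQ => ->; rewrite inE eqxx.
    rewrite !inE => xR yR xy.
    have cases u : [|| u \in P, u == z | (u + z)%R \in P] ->
        exists2 v, v = 0%R \/ v \in P & u = v \/ (u = v + z)%R.
      case/or3P=> uP; first by exists u; [right|left].
        by exists 0%R; [left|right; rewrite add0r (eqP uP)].
      by exists (u + z)%R; [right|right; rewrite addKz].
    have [v vP uv] := cases _ xR; have [w wP uw] := cases _ yR.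
    have vwP : (v + w = 0)%R \/ (v + w)%R \in P.
      case: vP wP => [->|vP] [->|wP]; rewrite ?add0r ?addr0; [by left|by right|by right|].
      by case: (eqVneq (v + w) 0)%R => [|vw]; [left|right; apply: cloP].
    have [E|E] : (x + y = v + w)%R \/ (x + y = v + w + z)%R.
    - case: uv uw => -> [->|->]; [by left|by right; rewrite addrA| |].
        by right; rewrite addrAC.
      by left; rewrite addrACA addvv addr0.
    - by rewrite E; case: vwP => [vw0|->//]; rewrite E vw0 eqxx in xy.
    rewrite E addKz; case: vwP => [->|->]; last by rewrite !orbT.
    by rewrite add0r eqxx orbT.
  apply/subsetP=> x; rewrite inE => /or3P[xP|/eqP->//|xzP].
    by rewrite (subsetP generator_quadric).
  rewrite -(addKz x); apply: perp => //.
  by rewrite -addv_eq0 addKz; apply: contraTneq xzP => ->; rewrite add0r.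
have [_ maxP] := maxsetP (etrans (esym (in_set _ _)) genP).
case/negP: nzP; rewrite -(maxP R tiR); first by rewrite inE eqxx orbT.
by apply/subsetP=> x xP; rewrite inE xP.
Qed.

End Generator.

(** * Search for generators *)

Definition code_set (l : seq N) : {set vec} := [set x | code x \in l].

(** Listing members in the fixed order of [quadric_codes] turns equality of sets into equality of
    lists. *)
Definition canon (l : seq N) : seq N := [seq n <- quadric_codes | n \in l].

Lemma codes_uniq : uniq codes.
Proof. by rewrite map_inj_uniq ?iota_uniq // => i j /Nat2N.inj. Qed.

Lemma canon_uniq l : uniq (canon l).
Proof. by rewrite !filter_uniq // codes_uniq. Qed.

Lemma quadric_codes_codes : {subset quadric_codes <= codes}.
Proof. by move=> n; rewrite mem_filter => /andP[]. Qed.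

Lemma canon_codes l : {subset canon l <= codes}.
Proof. by move=> n; rewrite mem_filter => /andP[_ /quadric_codes_codes]. Qed.

Lemma code_set_canon l :
  {subset l <= quadric_codes} -> code_set (canon l) = code_set l.
Proof.
move=> sub; apply/setP=> x; rewrite !inE mem_filter.
by case: (boolP (_ \in l)) => // /sub ->.
Qed.

Lemma mem_code_set_vec l n : n \in codes -> (vec_of n \in code_set l) = (n \in l).
Proof. by move=> n_in; rewrite inE vec_ofK. Qed.

Lemma code_set_inj l l' :
  code_set (canon l) = code_set (canon l') -> canon l = canon l'.
Proof.
move=> E; apply: eq_in_filter => n nQ.
have n_in := quadric_codes_codes nQ.
have := mem_code_set_vec (canon l) n_in; rewrite E mem_code_set_vec //.
by rewrite ![_ \in canon _]mem_filter nQ !andbT.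
Qed.

Lemma card_code_set l : uniq l -> {subset l <= codes} -> #|code_set l| = size l.
Proof.
move=> uniq_l sub; rewrite -(size_map vec_of).
have uniq_v : uniq (map vec_of l).
  by rewrite map_inj_in_uniq // => m n /sub m_in /sub n_in /(can_in_inj vec_ofK)->.
rewrite -(card_uniqP uniq_v); apply: eq_card => x; rewrite inE.
apply/idP/mapP => [xl|[n nl ->]]; first by exists (code x); rewrite ?codeK.
by rewrite vec_ofK // sub.
Qed.

Lemma card_code_setI l l' :
  #|code_set (canon l) :&: code_set (canon l')| = count [in canon l'] (canon l).
Proof.
rewrite -size_filter -card_code_set ?filter_uniq ?canon_uniq //.
  by apply: eq_card => x; rewrite !inE [RHS]mem_filter andbC.
by move=> n; rewrite mem_filter => /andP[_ /canon_codes].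
Qed.

(** Two distinct singular vectors are orthogonal iff their sum is singular. As 0 is not [singular],
    members of [s] are excluded. *)
Definition perp_codes (s : seq N) : seq N :=
  [seq y <- quadric_codes | all (fun z => singular (N.lxor y z)) s].

Definition extend (s : seq N) (x : N) : seq N :=
  canon (s ++ x :: map (N.lxor x) s).

Definition refine (ok : pred (seq N)) (s : seq N) : seq (seq N) :=
  let c := perp_codes s in
  if c is [::] then [:: s] else
    filter ok [seq extend s x | x <- c & ok (x :: s)].

Definition refine_all (ok : pred (seq N)) (ss : seq (seq N)) : seq (seq N) :=
  undup (flatten (map (refine ok) ss)).

(* [ok] discards partial lists that cannot extend to the generators looked for. *)
Definition generators_through (ok : pred (seq N)) (q : N) : seq (seq N) :=
  map canon (iter 3 (refine_all ok) [:: [:: q]]).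

Definition inside (P : {set vec}) (s : seq N) : Prop :=
  forall n, n \in s -> exists2 x, x \in P & n = code x.

Section Search.
Variable P : {set vec}.
Hypothesis genP : P \in generators.

Lemma generator_quadric_code x : x \in P -> code x \in quadric_codes.
Proof. by move=> xP; rewrite mem_quadric_codes (subsetP (generator_quadric genP)). Qed.

(** A point of [P] outside [s] has nonzero sums with the members of [s]; these lie in [P], hence are
    singular, and the point would be in [perp_codes s]. *)
Lemma inside_generator s : inside P s ->
  {in P, forall x, code x \notin perp_codes s} -> P = code_set s.
Proof.
move=> sP nperp; apply/setP=> x; rewrite inE; apply/idP/idP => [xP|/sP[y yP /code_inj->//]].
have := nperp x xP; rewrite mem_filter generator_quadric_code // andbT.
case/allPn=> z z_s; have [y yP zE] := sP z z_s; rewrite zE -code_add -quadricE => nQ.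
suff /eqP : (x + y)%R == 0%R by move/eqP; rewrite addv_eq0 => /eqP ->; rewrite -zE.
apply: contraNT nQ => xy; apply: (subsetP (generator_quadric genP)).
exact: (generator_closed genP).
Qed.

Lemma inside_refine (ok : pred (seq N)) s : (forall s, inside P s -> ok s) ->
  inside P s -> exists2 s', s' \in refine ok s & inside P s'.
Proof.
move=> okP sP; rewrite /refine; case E: (perp_codes s) => [|y0 ys].
  by exists s; rewrite ?mem_head.
rewrite -E; have y0_in : y0 \in perp_codes s by rewrite E mem_head.
(* Otherwise [s] is all of [P]; then [y0], orthogonal to [P], belongs to [P] by maximality, hence to
   [s], although y0 + y0 = 0 is not singular. *)
have [x xP x_in] : exists2 x, x \in P & code x \in perp_codes s.
  apply/exists_inP; apply: contraT => /exists_inPn nperp.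
  have PE := inside_generator sP nperp.
  move: (y0_in); rewrite mem_filter => /andP[/allP sing y0Q].
  have y0c := quadric_codes_codes y0Q.
  have zP : vec_of y0 \in P.
    apply: (generator_maximal genP) => [|x xP _].
      by rewrite -mem_quadric_codes vec_ofK.
    rewrite quadricE code_add N.lxor_comm vec_ofK // sing //.
    by move: xP; rewrite PE inE.
  by move: zP; rewrite PE mem_code_set_vec // => /sing; rewrite N.lxor_nilpotent.
have extP : inside P (extend s (code x)).
  move=> n; rewrite mem_filter mem_cat inE => /andP[n_in nQ].
  case/or3P: n_in => [/sP //|/eqP->|/mapP[m /sP[y yP ->] nE]]; first by exists x.
  exists (x + y)%R; last by rewrite code_add.
  apply: (generator_closed genP) => //; apply: contraTneq nQ => xy.
  by rewrite nE -code_add xy code0 mem_filter.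
exists (extend s (code x)) => //; rewrite mem_filter okP //=; apply: map_f.
rewrite mem_filter x_in andbT; apply: okP => n; rewrite inE => /predU1P[->|/sP//].
by exists x.
Qed.

Lemma inside_refine_all (ok : pred (seq N)) ss : (forall s, inside P s -> ok s) ->
  (exists2 s, s \in ss & inside P s) ->
  exists2 s, s \in refine_all ok ss & inside P s.
Proof.
move=> okP [s s_in sP]; have [s' s'_in s'P] := inside_refine okP sP.
by exists s' => //; rewrite mem_undup; apply/flatten_mapP; exists s.
Qed.

(** Every round keeps some list inside [P]. Three rounds lead from a point to vector dimension 4,
    and the completeness hypothesis certifies that nothing is left to add. *)
Lemma generator_code (ok : pred (seq N)) x : (forall s, inside P s -> ok s) -> x \in P ->
    all (fun s => perp_codes s == [::]) (generators_through ok (code x)) ->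
  exists2 s, canon s \in generators_through ok (code x) & P = code_set (canon s).
Proof.
move=> okP xP /allP complete.
have : exists2 s, s \in iter 3 (refine_all ok) [:: [:: code x]] & inside P s.
  elim: 3 => [|k IHk]; last exact: inside_refine_all.
  by exists [:: code x]; rewrite ?mem_head // => n; rewrite inE => /eqP->; exists x.
case=> s s_in sP; have c_in := map_f canon s_in; exists s => //.
apply: inside_generator => [n|y yP]; first by rewrite mem_filter => /andP[/sP].
by rewrite (eqP (complete _ c_in)).
Qed.

End Search.

(** * The action of the coordinate permutations *)

Definition swap_index (k : nat) (p : nat * nat) : nat :=
  if k == p.1 then p.2 else if k == p.2 then p.1 else k.

Definition word_index (w : seq (nat * nat)) (k : nat) : nat := foldl swap_index k w.

Definition word_perm (w : seq (nat * nat)) : 'S_9 :=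
  (\prod_(p <- w) tperm (inord p.1) (inord p.2))%g.

Definition word_ok (w : seq (nat * nat)) : bool :=
  all (fun p => [&& p.1 < 9, p.2 < 9 & p.1 != p.2]) w.

Lemma word_permE w (i : 'I_9) : word_ok w -> word_perm w i = word_index w i :> nat.
Proof.
rewrite /word_perm /word_index; elim: w i => [|p w IHw] i /=.
  by rewrite big_nil perm1.
case/andP=> /and3P[lt1 lt2 _] w_ok; rewrite big_cons permM IHw //.
congr foldl; rewrite /swap_index /tperm permE /=.
rewrite -!(inj_eq val_inj) /= !inordK //.
by do 2?case: ifP => // _; rewrite inordK.
Qed.

Lemma word_index_rev w k : word_index (rev w) (word_index w k) = k.
Proof.
rewrite /word_index; elim: w k => //= p w IHw k.
rewrite rev_cons foldl_rcons IHw /swap_index.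
by case: (eqVneq k p.1) => [->|n1]; last case: (eqVneq k p.2) => [->|n2];
   rewrite ?eqxx ?(negPf n1) ?(negPf n2) //; case: eqVneq.
Qed.

Lemma odd_word_perm w : word_ok w -> odd_perm (word_perm w) = odd (size w).
Proof.
rewrite /word_perm; elim: w => [|p w IHw] /=; first by rewrite big_nil odd_perm1.
case/andP=> /and3P[lt1 lt2 ne] /IHw IH; rewrite big_cons odd_permM odd_tperm IH.
by rewrite -(inj_eq val_inj) /= !inordK ?ne.
Qed.

Definition word_stab (w : seq (nat * nat)) : bool :=
  [&& word_ok w, ~~ odd (size w)
    & perm_eq [:: word_index w 0; word_index w 1] [:: 0; 1]].

Lemma word_perm_Gstar w : word_stab w -> word_perm w \in Gstar.
Proof.
case/and3P=> w_ok ev /perm_mem/(_ _) stab; rewrite inE Alt_even odd_word_perm // ev /=.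
rewrite !inE; apply/subsetP=> i; rewrite !inE /= /aperm.
rewrite -!(inj_eq val_inj) /= word_permE // !inordK // => i01.
have := stab (word_index w i); rewrite !inE => <-.
by case/orP: i01 => /eqP->; rewrite eqxx ?orbT.
Qed.

Lemma move_coordsE x (g : 'S_9) i : move_coords x g 0%R i = x 0%R (g^-1%g i).
Proof. by rewrite mxE. Qed.

Lemma move_coords_inj g : injective (move_coords^~ g).
Proof. exact: (act_inj coord_action). Qed.

Lemma move_coordsD g x y :
  (move_coords (x + y) g = move_coords x g + move_coords y g)%R.
Proof. by apply/rowP=> i; rewrite !mxE. Qed.

Lemma move_coords0 g : (move_coords 0 g = 0)%R.
Proof. by apply/rowP=> i; rewrite !mxE. Qed.

(** The entry at i of the moved vector is read at the preimage of i, which the reversed word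
    computes. *)
Definition move_code (w : seq (nat * nat)) : N -> N :=
  let idx := [seq N.of_nat (word_index (rev w) i) | i <- iota 0 9] in
  fun n => enc [seq N.testbit n k | k <- idx].

Lemma code_move w x : word_ok w ->
  code (move_coords x (word_perm w)) = move_code w (code x).
Proof.
move=> w_ok; rewrite /move_code -map_comp -val_enum_ord -map_comp; congr enc.
apply: eq_map => i /=; rewrite move_coordsE -bit_code.
by rewrite -{2}(permKV (word_perm w) i) word_permE // word_index_rev.
Qed.

Lemma singular_transposition i j n : i < 9 -> j < 9 -> n \in codes ->
  singular (move_code [:: (i, j)] n) = singular n.
Proof.
have chk : all (fun i => all (fun j =>
    all (fun n => singular (move_code [:: (i, j)] n) == singular n) codes)
    (iota 0 9)) (iota 0 9) by vm_compute.
move=> lt_i lt_j n_in; apply/eqP.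
have i_in : i \in iota 0 9 by rewrite mem_iota.
have j_in : j \in iota 0 9 by rewrite mem_iota.
exact: (allP (allP (allP chk i i_in) j j_in) n n_in).
Qed.

(** A permutation is a product of transpositions, and for these the invariance is checked on all
    codes. *)
Lemma move_quadric g x : (move_coords x g \in quadric) = (x \in quadric).
Proof.
have [ts -> ts_ok] := prod_tpermP g.
elim: ts ts_ok x => [|[i j] ts IHts] /= => [_|/andP[ij /IHts{}IHts]] x.
  by rewrite big_nil [move_coords _ _]move_coords1.
rewrite big_cons [move_coords _ _]move_coordsM IHts !quadricE.
have w_ok : word_ok [:: (i : nat, j : nat)] by rewrite /word_ok /= !ltn_ord /= andbT.
have -> : tperm i j = word_perm [:: (i : nat, j : nat)].
  by rewrite /word_perm big_seq1 /= !inord_val.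
by rewrite (code_move _ w_ok) singular_transposition ?ltn_ord ?code_in.
Qed.

Definition move_set (P : {set vec}) (g : 'S_9) : {set vec} :=
  [set move_coords x g | x in P].

Lemma mem_move_set P g x : (move_coords x g \in move_set P g) = (x \in P).
Proof. exact/mem_imset/move_coords_inj. Qed.

Lemma move_setK g : cancel (move_set^~ g) (move_set^~ g^-1%g).
Proof. exact: (actK coord_action^*). Qed.

Lemma move_set_isotropic P g : totally_isotropic P -> totally_isotropic (move_set P g).
Proof.
case/andP=> /proj_subspaceP[P0 cloP] PQ; apply/andP; split.
  apply/proj_subspaceP; split; first by rewrite -(move_coords0 g) mem_move_set.
  move=> _ _ /imsetP[x xP ->] /imsetP[y yP ->]; rewrite -move_coordsD mem_move_set.
  by move=> xy; apply: cloP => //; apply: contraNneq xy => ->; rewrite move_coords0.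
by apply/subsetP=> _ /imsetP[x xP ->]; rewrite move_quadric (subsetP PQ).
Qed.

Lemma move_set_generator P g : P \in generators -> move_set P g \in generators.
Proof.
rewrite !inE => /maxsetP[isoP maxP]; apply/maxsetP; split; first exact: move_set_isotropic.
move=> R isoR sPR; rewrite -(maxP (move_set R g^-1%g)).
- by rewrite -{2}(invgK g) move_setK.
- exact: move_set_isotropic.
- by rewrite -(move_setK g P); apply: imsetS.
Qed.

Lemma family_actionE S g : family_action S g = [set move_set P g | P in S].
Proof. by []. Qed.

Lemma move_spread S g : spread S -> spread (family_action S g).
Proof.
case/andP=> /subsetP genS partS; rewrite family_actionE; apply/andP; split.
  by apply/subsetP=> _ /imsetP[P /genS genP ->]; apply: move_set_generator.
have moveQ : [set move_coords x g | x in quadric] = quadric.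
  apply/setP=> x; apply/imsetP/idP => [[y yQ ->]|xQ]; first by rewrite move_quadric.
  exists (move_coords x g^-1%g); first by rewrite move_quadric.
  by rewrite [RHS](actKV coord_action).
by rewrite -(imset_partition S quadric (@move_coords_inj g)) moveQ in partS.
Qed.

(** The product is the 7-cycle 2, 3, ..., 8, an even permutation fixing 0 and 1. *)
Definition cycle_word : seq (nat * nat) := [seq (2, i) | i <- iota 3 6].

Lemma iter_word_perm w k (i : 'I_9) : word_ok w ->
  (word_perm w ^+ k)%g i = iter k (word_index w) i :> nat.
Proof.
by move=> w_ok; rewrite permX; elim: k => [//|k IHk]; rewrite !iterS -IHk word_permE.
Qed.

Lemma word_perm_expg_eq1 w k : word_ok w ->
  all (fun i => iter k (word_index w) i == i) (iota 0 9) ->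
  (word_perm w ^+ k = 1)%g.
Proof.
move=> w_ok /allP chk; apply/permP=> i; apply: ord_inj.
by rewrite perm1 iter_word_perm //; apply/eqP/chk; rewrite mem_iota ltn_ord.
Qed.

Lemma cycle_word_ok : word_ok cycle_word.
Proof. by vm_compute. Qed.

Lemma cycle_word_p_group : (7.-group <[word_perm cycle_word]>)%g.
Proof.
have g7 : (word_perm cycle_word ^+ 7 = 1)%g.
  by apply: word_perm_expg_eq1; vm_compute.
rewrite /pgroup -orderE; apply: (@pnat_dvd _ 7); last by rewrite pnat_id.
by rewrite order_dvdn g7.
Qed.

Lemma cycle_word_Gstar : word_perm cycle_word \in Gstar.
Proof. by apply: word_perm_Gstar; vm_compute. Qed.

Lemma Gstar_group : exists G : {group 'S_9}, Gstar = G.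
Proof. by exists ('N_('Alt_('I_9))([set pos1; pos2] | 'P))%G. Qed.

Lemma orbit_fixed_spread sys X :
    X \in orbit family_action Gstar @: spreads_in sys -> #|X| = 120 ->
  exists S, [/\ spread S, X = orbit family_action Gstar S
               & family_action S (word_perm cycle_word) = S].
Proof.
move=> /imsetP[S0]; rewrite inE => /andP[spS0 _] -> card_X.
have [G GE] := Gstar_group; rewrite GE in card_X *.
have gG : word_perm cycle_word \in G by rewrite -GE cycle_word_Gstar.
have act_orb : [acts <[word_perm cycle_word]>%g, on orbit family_action G S0 | family_action].
  apply: subset_trans (acts_orbit _ _ (subsetT G)).
  by rewrite cycle_subG.
(* The number of fixed spreads in the orbit is congruent to 120, so to 1, modulo 7; hence it is not
   zero. *)
have := pgroup_fix_mod cycle_word_p_group act_orb; rewrite card_X.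
case: (set_0Vmem
    ('Fix_(orbit family_action G S0 | family_action)(<[word_perm cycle_word]>))%g).
  by move=> ->; rewrite cards0.
case=> S /setIP[S_orb /afixP fixS] _; exists S; split.
- by case/orbitP: S_orb => g _ <-; apply: move_spread.
- by apply/esym/orbit_eqP.
- by apply: fixS; apply: cycle_id.
Qed.

(** * The fixed spreads *)

Definition qcode (i : nat) : N := enc [seq j != i | j <- iota 0 9].

Lemma code_Qpoint (i : 'I_9) : code (Qpoint i) = qcode i.
Proof.
rewrite /code /qcode -val_enum_ord; congr enc; rewrite -[RHS]map_comp.
apply: eq_map => j /=.
by rewrite mxE (inj_eq val_inj); case: (j != i)%R; rewrite ?oner_eq0 ?eqxx.
Qed.

Lemma move_Qpoint i g : move_coords (Qpoint i) g = Qpoint (g i).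
Proof.
apply/rowP=> j; rewrite !mxE; congr (_%:R)%R.
by rewrite -(inj_eq (@perm_inj _ g)) permKV.
Qed.

Lemma Qpoint_quadric i : Qpoint i \in quadric.
Proof.
have chk : all (fun i => singular (qcode i)) (iota 0 9) by vm_compute.
by rewrite quadricE code_Qpoint (allP chk) // mem_iota ltn_ord.
Qed.

(** The sum has weight 2 or 0. Consequently no generator contains two of these points, and the nine
    positions index distinct elements of a spread. *)
Lemma Qpoint_sum i j : (Qpoint i + Qpoint j)%R \notin quadric.
Proof.
have chk : all (fun i => all (fun j => ~~ singular (N.lxor (qcode i) (qcode j)))
  (iota 0 9)) (iota 0 9) by vm_compute.
rewrite quadricE code_add !code_Qpoint.
have i_in (k : 'I_9) : (k : nat) \in iota 0 9 by rewrite mem_iota ltn_ord.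
exact: (allP (allP chk _ (i_in i)) _ (i_in j)).
Qed.

Section SpreadAt.
Variable S : {set {set vec}}.
Hypothesis spS : spread S.

Lemma spread_trivIset : trivIset S.
Proof. by case/andP: spS => _ /partition_trivIset. Qed.

Lemma Qpoint_cover i : Qpoint i \in cover S.
Proof. by case/andP: spS => _ /cover_partition ->; apply: Qpoint_quadric. Qed.

Lemma spread_at_mem i : spread_at S i \in S.
Proof. exact/pblock_mem/Qpoint_cover. Qed.

Lemma Qpoint_spread_at i : Qpoint i \in spread_at S i.
Proof. by rewrite mem_pblock Qpoint_cover. Qed.

Lemma spread_at_generator i : spread_at S i \in generators.
Proof. by case/andP: spS => /subsetP genS _; apply/genS/spread_at_mem. Qed.

Lemma spread_at_inj : injective (spread_at S).
Proof.
move=> i j E; apply: contraTeq (Qpoint_sum i j) => ij; rewrite negbK.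
have genP := spread_at_generator i.
apply: (subsetP (generator_quadric genP)); apply: (generator_closed genP).
- exact: Qpoint_spread_at.
- by rewrite E Qpoint_spread_at.
- rewrite addv_eq0; apply: contra ij => /eqP/rowP/(_ i)/eqP; rewrite !mxE eqxx /=.
  by case: (eqVneq i j) => //= _; rewrite eq_sym oner_eq0.
Qed.

Lemma spread_at_disjoint i j x : x \in spread_at S i -> x \in spread_at S j -> i = j.
Proof.
move=> xi xj; apply: spread_at_inj.
rewrite -(def_pblock spread_trivIset (spread_at_mem i) xi).
exact: (def_pblock spread_trivIset (spread_at_mem j) xj).
Qed.

Lemma spread_at_move g i :
  spread_at (family_action S g) (g i) = move_set (spread_at S i) g.
Proof.
apply: def_pblock.
- by case/andP: (move_spread g spS) => _ /partition_trivIset.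
- by rewrite family_actionE; apply/imsetP; exists (spread_at S i); rewrite ?spread_at_mem.
- by rewrite -move_Qpoint mem_move_set Qpoint_spread_at.
Qed.

End SpreadAt.

Definition move_list (w : seq (nat * nat)) (l : seq N) : seq N :=
  canon (map (move_code w) l).

Lemma code_set_move w l : word_ok w -> code_set l \subset quadric ->
  {subset l <= codes} ->
  code_set (move_list w l) = move_set (code_set l) (word_perm w).
Proof.
move=> w_ok lQ lc; have moveE n : n \in l ->
    move_code w n = code (move_coords (vec_of n) (word_perm w)).
  by move=> /lc n_in; rewrite code_move // vec_ofK.
have memv n : n \in l -> vec_of n \in code_set l by move=> nl; rewrite mem_code_set_vec ?lc.
rewrite code_set_canon => [|_ /mapP[n nl ->]]; last first.
  by rewrite moveE // mem_quadric_codes move_quadric (subsetP lQ) ?memv.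
apply/setP=> x; rewrite inE; apply/mapP/imsetP => [[n nl xE]|[y yl ->]].
  by exists (vec_of n); [exact: memv|apply: code_inj; rewrite xE moveE].
by exists (code y); [rewrite inE in yl|rewrite code_move].
Qed.

(** A necessary condition on a block that [f] maps to itself: it contains [x] and the image of [y],
    so their sum is 0 or singular. *)
Definition stable_ok (f : N -> N) (s : seq N) : bool :=
  let t := map f s in
  all (fun x => all (fun y => let z := N.lxor x y in (z == 0%num) || singular z) t) s.

(** A necessary condition on the block at position 2, with [b] listing the two fixed blocks: the six
    further images of each of its points lie in other blocks. *)
Definition off_ok (f : N -> N) (b s : seq N) : bool :=
  all (fun x => (x \notin b) && all (fun y => y \notin s) (traject f (f x) 6)) s.

Definition fixed_blocks (i : nat) : seq (seq N) :=
  generators_through (stable_ok (move_code cycle_word)) (qcode i).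

Definition cycled_blocks (l1 l2 : seq N) : seq (seq N) :=
  generators_through (off_ok (move_code cycle_word) (l1 ++ l2)) (qcode 2).

Definition fixed_pairs : seq (seq N * seq N) :=
  let ls2 := fixed_blocks 1 in
  [seq p <- [seq (l1, l2) | l1 <- fixed_blocks 0, l2 <- ls2] | ~~ has [in p.2] p.1].

Definition cycled_spreads : seq (seq (seq N)) :=
  [seq p.1 :: p.2 :: traject (move_list cycle_word) l 7
     | p <- fixed_pairs, l <- cycled_blocks p.1 p.2].

Definition all_complete : pred (seq (seq N)) := all (fun s => perp_codes s == [::]).

(** Justifies stopping each search after three rounds: no singular vector extends any list that was
    found. *)
Lemma searches_complete :
  [&& all_complete (fixed_blocks 0), all_complete (fixed_blocks 1)
    & all (fun p => all_complete (cycled_blocks p.1 p.2)) fixed_pairs].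
Proof. by vm_compute. Qed.

Definition encodes (T : seq (seq N)) (S : {set {set vec}}) : Prop :=
  forall i : 'I_9, exists2 l, nth [::] T i = canon l & spread_at S i = code_set (canon l).

Lemma code_set_canon_quadric l : code_set (canon l) \subset quadric.
Proof. by apply/subsetP=> x; rewrite inE mem_filter mem_quadric_codes => /andP[]. Qed.

Lemma code_set_move_canon w l : word_ok w ->
  code_set (move_list w (canon l)) = move_set (code_set (canon l)) (word_perm w).
Proof.
move=> w_ok; apply: code_set_move => //; last exact: canon_codes.
exact: code_set_canon_quadric.
Qed.

(* Keeps unification from running the searches. *)
Opaque generators_through.

Section FixedSpread.
Variable S : {set {set vec}}.
Hypotheses (spS : spread S) (fixS : family_action S (word_perm cycle_word) = S).

Let g := word_perm cycle_word.
Let f := move_code cycle_word.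

Lemma spread_at_cycle (i j : 'I_9) : word_index cycle_word i = j ->
  spread_at S j = move_set (spread_at S i) g.
Proof.
move=> ij; rewrite -spread_at_move // fixS; congr spread_at.
by apply: ord_inj; rewrite word_permE ?cycle_word_ok.
Qed.

Lemma code_cycle x : f (code x) = code (move_coords x g).
Proof. by rewrite /f -code_move ?cycle_word_ok. Qed.

Lemma inside_stable (i : 'I_9) s : word_index cycle_word i = i ->
  inside (spread_at S i) s -> stable_ok f s.
Proof.
move=> fix_i sP; have genP := spread_at_generator spS i.
apply/allP=> x /sP[u uP ->]; apply/allP=> y' /mapP[y /sP[v vP ->] ->] /=.
rewrite code_cycle -code_add code_eq0 -quadricE; case: eqVneq => //= uv.
apply: (subsetP (generator_quadric genP)); apply: (generator_closed genP) => //.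
by rewrite (spread_at_cycle fix_i) mem_move_set.
Qed.

Lemma iter_spread_at k : k < 7 ->
  iter k (move_set^~ g) (spread_at S (inord 2)) = spread_at S (inord (2 + k)).
Proof.
have chk : all (fun i => word_index cycle_word (2 + i) == 2 + i.+1) (iota 0 6) by vm_compute.
elim: k => [//|k IHk] lt_k; rewrite iterS IHk ?(ltnW lt_k) //.
apply/esym/spread_at_cycle; rewrite !inordK; try by rewrite !addSn add0n !ltnS // ltnW.
by apply/eqP/(allP chk); rewrite mem_iota.
Qed.

Lemma inord9_eq (i j : nat) : i < 9 -> j < 9 -> inord i = inord j :> 'I_9 -> i = j.
Proof. by move=> lt_i lt_j E; rewrite -(inordK lt_i) E inordK. Qed.

Lemma blocks_disjoint (i j : nat) l1 l2 : i < 9 -> j < 9 -> i != j ->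
    spread_at S (inord i) = code_set (canon l1) ->
    spread_at S (inord j) = code_set (canon l2) ->
  ~~ has [in canon l2] (canon l1).
Proof.
move=> lt_i lt_j ij E1 E2; apply/hasPn=> n /= nl1; apply: contra ij => nl2.
have n_in := canon_codes nl1; apply/eqP/(inord9_eq lt_i lt_j).
by apply: (@spread_at_disjoint S spS _ _ (vec_of n)); rewrite ?E1 ?E2 mem_code_set_vec.
Qed.

Lemma inside_off l1 l2 s :
    spread_at S (inord 0) = code_set l1 -> spread_at S (inord 1) = code_set l2 ->
  inside (spread_at S (inord 2)) s -> off_ok f (l1 ++ l2) s.
Proof.
move=> E1 E2 sP.
apply/allP=> x /sP[u uP ->]; apply/andP; split.
  rewrite mem_cat; apply/norP; split; apply/negP => ul.
    have u1 : u \in spread_at S (inord 0) by rewrite E1 inE.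
    by have /inord9_eq := spread_at_disjoint spS u1 uP; move/(_ isT isT).
  have u2 : u \in spread_at S (inord 1) by rewrite E2 inE.
  by have /inord9_eq := spread_at_disjoint spS u2 uP; move/(_ isT isT).
apply/allP=> y /trajectP[k lt_k ->]; apply/negP=> /sP[v vP vE].
(* Applying the cycle k+1 times carries the block at position 2 to the one at position 2 + (k+1),
   which is disjoint from it. *)
suff vk : v \in spread_at S (inord (2 + k.+1)).
  have lt9 : 2 + k.+1 < 9 by rewrite (ltn_add2l 2 _ 7).
  by have /inord9_eq := spread_at_disjoint spS vP vk; move/(_ isT lt9).
rewrite -iter_spread_at //.
have iter_code m : iter m f (code u) = code (iter m (move_coords^~ g) u).
  by elim: m => //= m ->; rewrite code_cycle.
rewrite -iterSr iter_code in vE; rewrite -(code_inj vE).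
by elim: k.+1 {vE lt_k} => //= m; rewrite mem_move_set.
Qed.

Lemma spread_at_code (ok : pred (seq N)) i : i < 9 ->
    (forall s, inside (spread_at S (inord i)) s -> ok s) ->
    all_complete (generators_through ok (qcode i)) ->
  exists2 l, canon l \in generators_through ok (qcode i)
    & spread_at S (inord i) = code_set (canon l).
Proof.
move=> lt_i okP; have -> : qcode i = code (Qpoint (inord i)) by rewrite code_Qpoint inordK.
have codeP := generator_code (spread_at_generator spS _) okP (Qpoint_spread_at spS _).
by rewrite /all_complete; exact codeP.
Qed.

Lemma iter_move_canon l0 k :
  exists2 l, iter k (move_list cycle_word) (canon l0) = canon l
    & iter k (move_set^~ g) (code_set (canon l0)) = code_set (canon l).
Proof.
elim: k => [|k [l lE IHk]]; first by exists l0.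
exists (map (move_code cycle_word) (canon l)); first by rewrite iterS lE.
by rewrite iterS IHk -code_set_move_canon ?cycle_word_ok.
Qed.

Lemma encodes_blocks l1 l2 l3 :
    spread_at S (inord 0) = code_set (canon l1) ->
    spread_at S (inord 1) = code_set (canon l2) ->
    spread_at S (inord 2) = code_set (canon l3) ->
  encodes [:: canon l1, canon l2 & traject (move_list cycle_word) (canon l3) 7] S.
Proof.
move=> E1 E2 E3 i; rewrite -(inord_val i); case: i => -[|[|k]] lt_k /=.
- by exists l1; rewrite // inordK.
- by exists l2; rewrite // inordK.
have [l lE IHk] := iter_move_canon l3 k.
exists l; last by rewrite -IHk -E3 iter_spread_at.
have lt_k7 : k < 7 := lt_k.
rewrite inordK // -lE -(nth_traject _ lt_k7).
(* [nth_traject] has the starting list as default value and [encodes] the empty one; within range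
   they agree. *)
pose t := traject (move_list cycle_word) (canon l3) 7.
change (nth [::] t k = nth (canon l3) t k).
by apply: set_nth_default; rewrite size_traject.
Qed.

Lemma fixed_block_code i : i < 9 -> word_index cycle_word i = i ->
    all_complete (fixed_blocks i) ->
  exists2 l, canon l \in fixed_blocks i & spread_at S (inord i) = code_set (canon l).
Proof.
move=> lt_i fix_i; apply: spread_at_code => // s.
by apply: inside_stable; rewrite inordK.
Qed.

Lemma cycled_block_code l1 l2 : 
    spread_at S (inord 0) = code_set l1 -> spread_at S (inord 1) = code_set l2 ->
    all_complete (cycled_blocks l1 l2) ->
  exists2 l, canon l \in cycled_blocks l1 l2 & spread_at S (inord 2) = code_set (canon l).
Proof. by move=> E1 E2; apply: spread_at_code => // s; apply: inside_off. Qed.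

End FixedSpread.

Lemma mem_fixed_pairs l1 l2 : l1 \in fixed_blocks 0 -> l2 \in fixed_blocks 1 ->
  ~~ has [in l2] l1 -> (l1, l2) \in fixed_pairs.
Proof.
rewrite /fixed_pairs; move: (fixed_blocks 0) (fixed_blocks 1) => ls1 ls2 l1_in l2_in disj.
by rewrite mem_filter disj allpairs_f.
Qed.

Lemma fixed_pairs_complete l1 l2 :
  (l1, l2) \in fixed_pairs -> all_complete (cycled_blocks l1 l2).
Proof.
have /and3P[_ _] := searches_complete.
by move: fixed_pairs cycled_blocks all_complete => ps C A /allP H /H.
Qed.

Lemma mem_cycled_spreads l1 l2 l : (l1, l2) \in fixed_pairs -> l \in cycled_blocks l1 l2 ->
  [:: l1, l2 & traject (move_list cycle_word) l 7] \in cycled_spreads.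
Proof.
rewrite /cycled_spreads; move: fixed_pairs cycled_blocks => ps C p_in l_in.
by apply/allpairsPdep; exists (l1, l2), l.
Qed.

Lemma fixed_spread_encoded S :
    spread S -> family_action S (word_perm cycle_word) = S ->
  exists2 T, T \in cycled_spreads & encodes T S.
Proof.
move=> spS fixS; have /and3P[comp0 comp1 _] := searches_complete.
have [l1 l1_in E1] := fixed_block_code spS fixS (isT : 0 < 9) erefl comp0.
have [l2 l2_in E2] := fixed_block_code spS fixS (isT : 1 < 9) erefl comp1.
have disj := blocks_disjoint spS (isT : 0 < 9) (isT : 1 < 9) isT E1 E2.
have p_in := mem_fixed_pairs l1_in l2_in disj.
have [l3 l3_in E3] := cycled_block_code spS fixS E1 E2 (fixed_pairs_complete p_in).
exists [:: canon l1, canon l2 & traject (move_list cycle_word) (canon l3) 7].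
  exact: mem_cycled_spreads p_in l3_in.
exact: encodes_blocks E1 E2 E3.
Qed.

(** * The orbit of a fixed spread *)

(* Words for the permutations of the positions 4, ..., 8, with the
   transposition of 0 and 1 added to the odd ones.  They represent the cosets
   of the stabiliser of order 42 because the symmetric group on 7 points is
   the product of AGL(1,7) and the stabiliser of two points. *)
Definition coset_words : seq (seq (nat * nat)) :=
  let even_word w :=
    let v := [seq p <- w | p.1 != p.2] in if odd (size v) then (0, 1) :: v else v in
  map even_word
    (foldr (fun k ws => [seq (k, i) :: w | i <- iota k (9 - k), w <- ws]) [:: [::]] (iota 4 4)).

(** The block at position i of the moved spread is the image of the block at the preimage of i. *)
Definition move_codes (w : seq (nat * nat)) (T : seq (seq N)) : seq (seq N) :=
  [seq move_list w (nth [::] T (word_index (rev w) i)) | i <- iota 0 9].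

Module PositiveSet := MSetPositive.PositiveSet.

(** Tries are indexed by positive numbers, so codes are shifted by one to accommodate 0. *)
Definition trie (l : seq N) : PositiveSet.t :=
  foldr (fun n t => PositiveSet.add (N.succ_pos n) t) PositiveSet.empty l.

Definition in_trie (t : PositiveSet.t) (n : N) : bool :=
  PositiveSet.mem (N.succ_pos n) t.

Lemma in_trieE l n : in_trie (trie l) n = (n \in l).
Proof.
rewrite /in_trie; elim: l => [|m l IHl] /=.
  by apply/negbTE/negP => H; apply: (PositiveSet.empty_spec H).
rewrite inE -IHl; apply/idP/orP.
  case/PositiveSet.add_spec => [E|]; last by right.
  by left; apply/eqP/N.succ_inj; rewrite -!N.succ_pos_spec E.
by move=> H; apply/PositiveSet.add_spec; case: H => [/eqP->|]; [left|right].
Qed.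

Definition meet_dim (l : seq N) (t : PositiveSet.t) : nat := ldim (count (in_trie t) l).

(* U lists the blocks of one spread as lists of codes, V those of another one
   as tries. *)
Definition code_adj (U : seq (seq N)) (V : seq PositiveSet.t) : bool :=
  let u1 := nth [::] U 0 in let u2 := nth [::] U 1 in
  let d := (meet_dim u1 (nth PositiveSet.empty V 1)
            + meet_dim u2 (nth PositiveSet.empty V 0))%N in
  let m := count (fun t => (meet_dim u1 t == 2) && (meet_dim u2 t == 2)) (drop 2 V) in
  [|| (d == 0) && (m == 2), (d == 4) && (m == 2) | (d == 2) && (m == 3)].

Definition code_orbit (T : seq (seq N)) : seq (seq (seq N)) :=
  [seq move_codes w T | w <- coset_words].

Definition matrix_rel (M : seq (seq bool)) : rel nat :=
  fun i j => nth false (nth [::] M i) j.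

Definition orbit_matrix (T : seq (seq N)) : seq (seq bool) :=
  let Us := code_orbit T in
  let Vs := map (map trie) Us in [seq [seq code_adj U V | V <- Vs] | U <- Us].

(** The 120 images must be distinct in order to exhaust an orbit of size 120. *)
Definition certificate (T : seq (seq N)) : bool :=
  uniq (code_orbit T) &&
    (let r := matrix_rel (orbit_matrix T) in
    [&& all (fun i => ~~ r i i) (iota 0 120),
        fibration_obstruction 119 r & geometry_obstruction 119 r]).

Transparent generators_through.

Lemma cycled_spreads_certified : all certificate cycled_spreads.
Proof. by vm_compute. Qed.

Opaque generators_through.

Lemma coset_wordsP : (size coset_words == 120) && all word_stab coset_words.
Proof. by vm_compute. Qed.

Opaque coset_words.

Lemma encodes_move w T S : word_ok w -> spread S -> encodes T S ->
  encodes (move_codes w T) (family_action S (word_perm w)).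
Proof.
move=> w_ok spS encT i; rewrite -(permKV (word_perm w) i); set j := (_^-1%g : {perm _}) i.
have [l lE SE] := encT j; exists (map (move_code w) (canon l)); last first.
  by rewrite spread_at_move // SE -code_set_move_canon.
rewrite (nth_map 0) ?size_iota // nth_iota // add0n word_permE // word_index_rev.
by rewrite lE.
Qed.

Lemma size_move_codes w T : size (move_codes w T) = 9.
Proof. by rewrite size_map size_iota. Qed.

Lemma pdim_meet l l' :
    proj_subspace (code_set (canon l)) -> proj_subspace (code_set (canon l')) ->
  pdim (code_set (canon l) :&: code_set (canon l'))
    = ((meet_dim (canon l) (trie (canon l')))%:Z - 1)%R.
Proof.
move=> subl subl'; rewrite pdimE; last exact: proj_subspaceI.
rewrite /meet_dim card_code_setI; congr (_%:Z - 1)%R; congr ldim.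
by apply: eq_count => n; rewrite /= in_trieE.
Qed.

(** Vector dimensions exceed projective ones by 1, so the values -2, 2, 0 of [Inv1] become 0, 4, 2,
    and meeting in a line becomes dimension 2. *)
Lemma Gamma_star_adjE U V S R : spread S -> spread R -> encodes U S -> encodes V R ->
  size V = 9 -> Gamma_star_adj S R = (S != R) && code_adj U (map trie V).
Proof.
move=> spS spR encU encV sizeV; congr (_ && _).
have sub Z (spZ : spread Z) i := generator_subspace (spread_at_generator spZ i).
have meet (i j : 'I_9) : pdim (spread_at S i :&: spread_at R j)
    = ((meet_dim (nth [::] U i) (nth PositiveSet.empty (map trie V) j))%:Z - 1)%R.
  have [l lE SE] := encU i; have [m mE RE] := encV j.
  rewrite (nth_map [::]) ?sizeV ?ltn_ord // SE RE lE mE; apply: pdim_meet.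
    by rewrite -SE; apply: sub.
  by rewrite -RE; apply: sub.
have v1 : pos1 = 0 :> nat by rewrite inordK.
have v2 : pos2 = 1 :> nat by rewrite inordK.
pose u1 := nth [::] U 0; pose u2 := nth [::] U 1.
pose cond t := (meet_dim u1 t == 2) && (meet_dim u2 t == 2).
have Inv2E : Inv2 S R = count cond (drop 2 (map trie V)).
  rewrite /Inv2; set A := [set _ | i : 'I_9 & _].
  have -> : [set P in A | (pdim (P :&: spread_at S pos1) == 1%R)
      && (pdim (P :&: spread_at S pos2) == 1%R)]
    = spread_at R @: [set i : 'I_9 | (1 < i) && cond (nth PositiveSet.empty (map trie V) i)].
    have condE (i : 'I_9) : cond (nth PositiveSet.empty (map trie V) i)
        = (pdim (spread_at R i :&: spread_at S pos1) == 1%R)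
          && (pdim (spread_at R i :&: spread_at S pos2) == 1%R).
      rewrite ![spread_at R i :&: _]setIC !meet v1 v2 !subr_eq.
      by rewrite -[(1 + 1)%R]/(2%:Z)%R !eqz_nat.
    apply/setP=> P; rewrite inE; apply/andP/imsetP => [[/imsetP[i i1 ->] c]|[i + ->]].
      by exists i; rewrite // inE condE c andbT; move: i1; rewrite inE.
    by rewrite inE condE => /andP[i1 ->]; split=> //; apply: imset_f; rewrite inE.
  (* Distinct positions hold distinct generators, so generators can be counted by position. *)
  rewrite card_imset; last exact: spread_at_inj.
  rewrite -(@count_iota 8 (fun i => (1 < i) && cond (nth PositiveSet.empty (map trie V) i))).
  rewrite -{2}(mkseq_nth PositiveSet.empty (map trie V)) size_map sizeV /mkseq -map_drop.
  by rewrite count_map.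
rewrite /Inv1 !meet Inv2E v1 v2 /code_adj -/u1 -/u2 -/cond.
set a := meet_dim _ _; set b := meet_dim _ _; set m := count _ _.
rewrite !inE !xpair_eqE.
have -> : (a%:Z - 1 + (b%:Z - 1) = (a + b)%N%:Z - 2)%R.
  by rewrite PoszD addrACA -opprD.
have eqz (c d : nat) : ((a + b)%N%:Z - 2%:Z == c%:Z - 2%:Z)%R = (a + b == c)%N.
  by rewrite (inj_eq (addIr _)) eqz_nat.
cbv zeta; congr [|| _ && _, _ && _ | _ && _].
- exact: (eqz 0).
- exact: (eqz 4).
- exact: (eqz 2).
Qed.

Lemma graph_iso_trans (T U V : finType) (e : rel T) (e' : rel U) (e'' : rel V) :
  graph_iso e e' -> graph_iso e' e'' -> graph_iso e e''.
Proof.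
move=> [f bij_f fE] [g bij_g gE]; exists (g \o f); first exact: bij_comp.
by move=> x y; rewrite /= gE fE.
Qed.

Lemma code_set_list_inj U V S : encodes U S -> encodes V S ->
  size U = 9 -> size V = 9 -> U = V.
Proof.
move=> encU encV sU sV; apply: (@eq_from_nth _ [::]) => [|i]; first by rewrite sU.
rewrite sU => lt_i; have [l /= -> SE] := encU (Ordinal lt_i).
by have [m /= -> SE'] := encV (Ordinal lt_i); apply: code_set_inj; rewrite -SE.
Qed.

(** * The orbit of size 120 identified with the computed graph *)

Section OrbitGraph.
Variables (T : seq (seq N)) (S : {set {set vec}}) (X : {set {set {set vec}}}).
Hypotheses (encT : encodes T S) (spS : spread S).
Hypotheses (XE : X = orbit family_action Gstar S) (cardX : #|X| = 120).
Hypothesis uniqT : uniq (code_orbit T).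

Let word (i : 'I_120) := nth [::] coset_words i.
Let image i := family_action S (word_perm (word i)).
Let codes_of i := move_codes (word i) T.

Lemma word_stabP i : word_stab (word i).
Proof.
by have /andP[/eqP sz /allP ok] := coset_wordsP; apply/ok/mem_nth; rewrite sz.
Qed.

Lemma image_in i : image i \in X.
Proof. by rewrite XE; apply/mem_orbit/word_perm_Gstar/word_stabP. Qed.

Lemma image_spread i : spread (image i).
Proof. exact: move_spread. Qed.

Lemma image_encodes i : encodes (codes_of i) (image i).
Proof. by apply: encodes_move => //; case/and3P: (word_stabP i). Qed.

Lemma codes_ofE i : codes_of i = nth [::] (code_orbit T) i.
Proof. by have /andP[/eqP sz _] := coset_wordsP; rewrite (nth_map [::]) ?sz. Qed.

(** A spread determines its list of canonical blocks, and these lists are pairwise different by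
    [uniqT]. *)
Lemma image_inj : injective image.
Proof.
move=> i j E; have encj := image_encodes j; rewrite -E in encj.
have := code_set_list_inj (image_encodes i) encj
  (size_move_codes _ _) (size_move_codes _ _).
have /andP[/eqP sz _] := coset_wordsP.
rewrite !codes_ofE => /eqP; rewrite nth_uniq ?size_map ?sz // => /eqP.
exact: val_inj.
Qed.

Lemma orbit_graph_iso :
  all (fun i => ~~ matrix_rel (orbit_matrix T) i i) (iota 0 120) ->
  graph_iso (fun i j : 'I_120 => matrix_rel (orbit_matrix T) i j) (@Gamma_star X).
Proof.
move=> irr; pose phi i : {R | R \in X} := exist _ (image i) (image_in i).
have phi_inj : injective phi by move=> i j /(congr1 val); apply: image_inj.
exists phi; first by apply: inj_card_bij phi_inj _; rewrite card_sig card_ord cardX.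
move=> i j; rewrite /Gamma_star /=.
rewrite (Gamma_star_adjE (image_spread i) (image_spread j)
  (image_encodes i) (image_encodes j)); last exact: size_move_codes.
have sz : size (code_orbit T) = 120.
  by have /andP[/eqP sz _] := coset_wordsP; rewrite size_map sz.
have rE : matrix_rel (orbit_matrix T) i j = code_adj (codes_of i) (map trie (codes_of j)).
  rewrite /matrix_rel /orbit_matrix (nth_map [::]) ?sz // (nth_map [::]) ?size_map ?sz //.
  by rewrite (nth_map [::]) ?sz // !codes_ofE.
(* [code_adj] has no test for distinctness, so the diagonal is settled by [irr]. *)
rewrite rE (inj_eq image_inj); case: eqVneq => //= ij; rewrite -rE ij.
by apply/esym/negbTE/(allP irr); rewrite mem_iota ltn_ord.
Qed.

End OrbitGraph.

Theorem mainTheorem4 (sys : {set {set vec}}) (X : {set {set {set vec}}}) :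
  sys \in systems ->
  X \in orbit family_action Gstar @: spreads_in sys ->
  #|X| = 120 ->
  [/\ ~ from_Wallis (@Gamma_star X),
      ~ from_GS_compl (@Gamma_star X)
    & ~ from_partial_geometry (@Gamma_star X)].
Proof.
move=> _ X_orb cardX.
have [S [spS XE fixS]] := orbit_fixed_spread X_orb cardX.
have [T T_in encT] := fixed_spread_encoded spS fixS.
have /andP[uniqT /and3P[irr fib geo]] := allP cycled_spreads_certified _ T_in.
have iso := orbit_graph_iso encT spS XE cardX uniqT irr.
(* From here on only the certificates and the isomorphism matter: any realisation of the graph on
   [X] is transported to a realisation of [r]. *)
move: fib geo irr iso; move: (matrix_rel _) => r.
clear T T_in encT uniqT => fib geo irr iso.
pose e : rel 'I_120 := fun i j => r i j; have eE (i j : 'I_120) : e i j = r i j by [].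
have nofib := no_bicoloured_fibration eE fib.
split.
- case=> A [B [L [cls [lab [data iso']]]]]; apply/nofib/from_Wallis_fibration.
  by exists A, B, L, cls, lab; split=> //; apply: graph_iso_trans iso iso'.
- case=> A [L [H [j0 [col [data iso']]]]]; apply/nofib/from_GS_compl_fibration.
  by exists A, L, H, j0, col; split=> //; apply: graph_iso_trans iso iso'.
- case=> P [L [I [s [t [alpha [pgI iso']]]]]].
  apply: (no_partial_geometry eE _ geo).
    by move=> i; apply/negbTE/(allP irr); rewrite mem_iota ltn_ord.
  by exists P, L, I, s, t, alpha; split=> //; apply: graph_iso_trans iso iso'.
Qed.
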